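(* Let $\Pi = (0,1]\times[0,1]$ and let $f:\Pi\to\mathbb{C}$ be an analytic function in $\Pi$, with the following three properties near the left segment $\{0\}\times[0,1]$: (1) The boundary trace defined as $h(z_2)=f(0,z_2)$ is an analytic function of $z_2\in[0,1]$. (2) For each $z_2\in[0,1]$, $f$ satisfies the following uniform growth condition: $f(z_1,z_2)-h(z_2)=\mathcal{O}(|z_1|^\delta)$ as $z_1\to 0$, for some $\delta>0$ that is independent of $z_2$. (3) For each $z_2\in[0,1]$, the univariate function $f(\cdot,z_2)$ can be analytically continued to a disk near $z_1=0$ with a slit along the negative real axis. Then, for $1\le n<\infty$, there exists a multivariate rational function $r_n$ of the form $$r_n(z_1,z_2)=\sum_{j=0}^{n-1}\frac{s_j(z_2)}{z_1-\beta_j}+p(z_1,z_2),$$ such that $$\|f-r_n\|_{\infty,\Pi}=\mathcal{O}(e^{-C\sqrt{n}})\quad\text{as } n\to\infty,$$ for some $C>0$. Here each $s_j$ is a univariate polynomial of degree scaling as $\mathcal{O}(\sqrt{n})$, $p$ is a bivariate polynomial of degree scaling as $\mathcal{O}(\sqrt{n})$ as $n\to\infty$, and the poles $\beta_j$ are finite and exponentially clustered towards $0$: they are given by $$\beta_j=-R\,e^{-\sigma j/\sqrt{n}},\qquad 0\le j\le n-1,$$ where the clustering parameter $\sigma>0$ is arbitrary and $R>1$ is some sufficiently large constant.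
   Context: $\|g\|_{\infty,\Pi}=\sup_{(z_1,z_2)\in\Pi}|g(z_1,z_2)|$. A function is analytic on a (real) set if it extends analytically to a complex neighborhood of each point of that set. Since $\Pi$ does not contain the segment $\{0\}\times[0,1]$, $f(0,z_2)$ denotes the boundary value of $f(z_1,z_2)$ as $z_1\to0$. The polynomials $s_j$ and $p$ may depend on $n$.
   Formalization: Properties (2)-(3) are required jointly: near each (0,z_2), f and h continue analytically to z_1 in a slit disk and z_2 in a complex disk, with the O(|z_1|^delta) bound there; for real z_2 only the claim fails, e.g. f=z_1/(z_2+sqrt(z_1)). *)

(* Defs.v *)
From Stdlib Require Import Reals.
From Coquelicot Require Import Coquelicot.

Open Scope R_scope.

(* Convergence of power series in C is with respect to the scalar field C. *)
Definition analytic1_at (F : C -> C) (c : C) : Prop :=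
  exists (a : nat -> C) (r : R), 0 < r /\
    forall z : C, Cmod (z - c)%C < r ->
      @is_pseries C_AbsRing C_NormedModule a (z - c)%C (F z).

(* Degree-n block of the double power series sum_{j,k} a j k u^j v^k. *)
Definition homog_part (a : nat -> nat -> C) (u v : C) (n : nat) : C :=
  sum_n (fun k : nat => (a (n - k)%nat k * Cpow u (n - k) * Cpow v k)%C) n.

Definition homog_part_abs (a : nat -> nat -> C) (u v : C) (n : nat) : R :=
  sum_n (fun k : nat =>
           Cmod (a (n - k)%nat k * Cpow u (n - k) * Cpow v k)%C) n.

(* F is the sum of an absolutely convergent double power series on a polydisk
   about (c1, c2); absolute convergence makes the grouping by total degree
   immaterial. *)
Definition analytic2_at (F : C -> C -> C) (c1 c2 : C) : Prop :=
  exists (a : nat -> nat -> C) (r : R), 0 < r /\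
    forall z1 z2 : C, Cmod (z1 - c1)%C < r -> Cmod (z2 - c2)%C < r ->
      ex_series (homog_part_abs a (z1 - c1)%C (z2 - c2)%C) /\
      @is_series C_AbsRing C_NormedModule
        (homog_part a (z1 - c1)%C (z2 - c2)%C) (F z1 z2).

(* Analyticity on a real set: local extension to a complex neighborhood of each
   point of the set.  Values of g outside S are irrelevant. *)
Definition analytic1_on (S : R -> Prop) (g : R -> C) : Prop :=
  forall y : R, S y ->
    exists (G : C -> C) (r : R), 0 < r /\ analytic1_at G (RtoC y) /\
      forall y' : R, S y' -> Rabs (y' - y) < r -> G (RtoC y') = g y'.

Definition analytic2_on (S : R -> R -> Prop) (g : R -> R -> C) : Prop :=
  forall x y : R, S x y ->
    exists (G : C -> C -> C) (r : R), 0 < r /\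
      analytic2_at G (RtoC x) (RtoC y) /\
      forall x' y' : R, S x' y' -> Rabs (x' - x) < r -> Rabs (y' - y) < r ->
        G (RtoC x') (RtoC y') = g x' y'.

Definition unit_segment (y : R) : Prop := 0 <= y <= 1.

Definition Pi_set (x y : R) : Prop := 0 < x <= 1 /\ 0 <= y <= 1.

Definition sup_norm_Pi (g : R -> R -> C) : Rbar :=
  Lub_Rbar (fun v : R => exists x y : R, Pi_set x y /\ v = Cmod (g x y)).

Definition boundary_trace (f : R -> R -> C) (h : R -> C) : Prop :=
  forall y : R, unit_segment y ->
    filterlim (fun x : R => f x y) (at_right 0) (locally (h y)).

Definition slit_disk (rho : R) (z : C) : Prop :=
  Cmod z < rho /\ ~ (Im z = 0 /\ Re z <= 0).

(* Behavior of f at the point (0, y) of the left segment.  As for analyticity on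
   a real set, it is expressed on a complex neighborhood of the point: f and h
   continue analytically, to F and H, for z1 in a slit disk about 0 and z2 in a
   complex disk about y, with F - H = O(|z1|^delta) as z1 -> 0 uniformly in z2
   in that disk.  The radius rho and the constant M may depend on y, delta may
   not.  Keeping z2 real (even with rho and M independent of y) is not enough
   for the approximation result: z1 / (z2 + sqrt z1) has singularities in z2
   approaching [0, 1] as z1 -> 0, and its best approximations by polynomials of
   degree O(sqrt n) in z2, at z1 = 1 / n^2, have error at least of order 1/n. *)
Definition slit_continuation (f : R -> R -> C) (h : R -> C) (delta y : R)
  : Prop :=
  exists (rho M : R) (F : C -> C -> C) (H : C -> C), 0 < rho /\
    (forall z1 z2 : C, slit_disk rho z1 -> Cmod (z2 - RtoC y)%C < rho ->
       analytic2_at F z1 z2) /\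
    (forall x' y' : R, Pi_set x' y' -> x' < rho -> Rabs (y' - y) < rho ->
       F (RtoC x') (RtoC y') = f x' y') /\
    (forall z2 : C, Cmod (z2 - RtoC y)%C < rho -> analytic1_at H z2) /\
    (forall y' : R, unit_segment y' -> Rabs (y' - y) < rho ->
       H (RtoC y') = h y') /\
    (forall z1 z2 : C, slit_disk rho z1 -> Cmod (z2 - RtoC y)%C < rho ->
       Cmod (F z1 z2 - H z2)%C <= M * Rpower (Cmod z1) delta).

Definition poly1_deg_le (d : nat) (P : C -> C) : Prop :=
  exists a : nat -> C, forall z : C,
    P z = sum_n (fun k : nat => (a k * Cpow z k)%C) d.

(* Total degree at most d. *)
Definition poly2_deg_le (d : nat) (P : C -> C -> C) : Prop :=
  exists a : nat -> nat -> C, forall z1 z2 : C,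
    P z1 z2 = sum_n (homog_part a z1 z2) d.

(* u = O(v) as n -> oo, for sequences with nonnegative values. *)
Definition is_bigO (u : nat -> Rbar) (v : nat -> R) : Prop :=
  exists M : R, eventually (fun n : nat => Rbar_le (u n) (Finite (M * v n))).

Definition pole (rad sigma : R) (n j : nat) : R :=
  - rad * exp (- sigma * INR j / sqrt (INR n)).

(* For n >= 1 the sum runs over 0 <= j <= n - 1 (sum_n has an inclusive upper
   bound). *)
Definition rational_form (n : nat) (beta : nat -> R) (s : nat -> C -> C)
  (p : C -> C -> C) (z1 z2 : C) : C :=
  (sum_n (fun j : nat => s j z2 / (z1 - RtoC (beta j))) (n - 1) + p z1 z2)%C.

(* Main.v *)
Require Import Defs.
From Stdlib Require Import Reals.
From Coquelicot Require Import Coquelicot.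
From Stdlib Require Import Lra Lia Psatz Classical ClassicalEpsilon List.
Import ListNotations.
Open Scope R_scope.

(** The proof approximates [f] by local polynomials, glued together with a partition
    of unity whose members are themselves rational functions with the prescribed
    poles.

    Write [b j] for minus the poles.  Expanding the product of the [x + b j] into
    powers of [x] and dividing by the product gives [n + 1] positive functions
    [weight b n k x] with sum 1.  They are the probabilities that exactly [n - k] of
    [n] independent events occur, the [j]-th having probability [b j / (x + b j)].
    The number of these events concentrates, so each weight is
    peaked at some [c]; and since every unit interval of the relevant part of the
    logarithmic scale contains of the order of [sqrt n] of the [log (b j)], the weight at [x] is at most
    [growth x c ^ (- m)] with [m] proportional to [sqrt n] ([weight_decay]).  This
    follows from a multiplicative form of log-concavity ([weight_four_points]).  The
    Bernstein polynomials of degree proportional to [sqrt n] play the same part in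
    the variable [y] ([bern_decay]).

    Attached to a pair of weights with peaks [c] and [y0] is a polynomial [T] of
    degree [q] in each variable, [q] being a small multiple of [sqrt n], which is
    geometrically close to [f] for [x] within [e * c] of [c] and [y] within [e] of
    [y0], and grows at most geometrically elsewhere ([local_approx]).  The sum of all
    products of two weights with their [T] is close to [f]: nearby peaks contribute
    good approximations, and distant ones are suppressed, because the decay of the
    weights beats the growth of the polynomials when [q] is small compared with [m].
    Peaks below [2 * tau], where [tau] is exponentially small in [sqrt n], use [f] at
    [2 * tau] in place of the boundary values; here the bound on
    [f - h] enters.  By partial fractions ([sf_power_over_denom]) a weight times a
    polynomial has exactly the required form.

    It remains to find the local polynomials, uniformly up to the left segment.  Away
    from it they are truncated power series, made uniform by compactness.  Near
    [(0, y)] the available disks about [c] have radius proportional to [c], and one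
    must convert local analyticity and boundedness on such a disk into geometric
    approximation.  This is done by Newton interpolation: a difference quotient
    [(g z - g p) / (z - p)] is again analytic, and by the maximum principle it exceeds
    the bound of [g] by at most a constant factor ([difference_quotient_bound]), so
    that the interpolation error is a product of many small factors
    ([newton_two_variables]).  The maximum principle itself follows from the second order
    Taylor expansion at a maximum ([four_point_mean]). *)

(** * Finite sums *)

(* Rewriting inside [sum_n] leaves equations typed in the carrier of a canonical
   structure, which [ring] does not recognize. *)
Ltac cring := match goal with |- @eq _ ?a ?b => change (@eq C a b) end; ring.

Lemma csum_O (a : nat -> C) : sum_n a 0 = a 0%nat.
Proof. apply sum_O. Qed.

Lemma csum_S (a : nat -> C) n : sum_n a (S n) = (sum_n a n + a (S n))%C.
Proof. rewrite sum_Sn; reflexivity. Qed.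

Lemma csum_ext (a b : nat -> C) n :
  (forall k, (k <= n)%nat -> a k = b k) -> sum_n a n = sum_n b n.
Proof. intros H; apply sum_n_ext_loc; auto. Qed.

Lemma csum_plus (a b : nat -> C) n :
  sum_n (fun k => (a k + b k)%C) n = (sum_n a n + sum_n b n)%C.
Proof.
  induction n as [|n IH]; [now rewrite !csum_O|].
  rewrite !csum_S, IH; cring.
Qed.

Lemma csum_mult_l (c : C) (a : nat -> C) n :
  sum_n (fun k => (c * a k)%C) n = (c * sum_n a n)%C.
Proof.
  induction n as [|n IH]; [now rewrite !csum_O|].
  rewrite !csum_S, IH; cring.
Qed.

Lemma csum_zero (a : nat -> C) n :
  (forall k, (k <= n)%nat -> a k = 0%C) -> sum_n a n = RtoC 0.
Proof.
  intros H; induction n as [|n IH].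
  - rewrite csum_O; apply H; lia.
  - rewrite csum_S, IH, H by (intros; try apply H; lia); cring.
Qed.

Lemma csum_single (a : nat -> C) n i : (i <= n)%nat ->
  (forall k, (k <= n)%nat -> k <> i -> a k = 0%C) -> sum_n a n = a i.
Proof.
  induction n as [|n IH]; intros Hi H.
  - rewrite csum_O; f_equal; lia.
  - rewrite csum_S. destruct (Nat.eq_dec i (S n)) as [->|ne].
    + rewrite csum_zero by (intros; apply H; lia); cring.
    + rewrite IH, (H (S n)) by (try lia; intros; apply H; lia); cring.
Qed.

Lemma Cmod_csum (a : nat -> C) (b : nat -> R) n :
  (forall k, (k <= n)%nat -> Cmod (a k) <= b k) ->
  Cmod (sum_n a n) <= sum_n b n.
Proof.
  induction n as [|n IH]; intros H.
  - rewrite csum_O, sum_O; apply H; lia.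
  - rewrite csum_S, sum_Sn. unfold plus; simpl.
    eapply Rle_trans; [apply Cmod_triangle|].
    apply Rplus_le_compat; [apply IH; intros; apply H|apply H]; lia.
Qed.

Ltac rring := match goal with |- @eq _ ?a ?b => change (@eq R a b) end; ring.

Lemma rsum_O (a : nat -> R) : sum_n a 0 = a 0%nat.
Proof. apply sum_O. Qed.

Lemma rsum_S (a : nat -> R) n : sum_n a (S n) = sum_n a n + a (S n).
Proof. rewrite sum_Sn; reflexivity. Qed.

Lemma rsum_ext (a b : nat -> R) n :
  (forall k, (k <= n)%nat -> a k = b k) -> sum_n a n = sum_n b n.
Proof. intros H; apply sum_n_ext_loc; auto. Qed.

Lemma rsum_mult_l (c : R) (a : nat -> R) n :
  sum_n (fun k => c * a k) n = c * sum_n a n.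
Proof.
  induction n as [|n IH]; [now rewrite !rsum_O|]. rewrite !rsum_S, IH; rring.
Qed.

Lemma rsum_plus (a b : nat -> R) n :
  sum_n (fun k => a k + b k) n = sum_n a n + sum_n b n.
Proof.
  induction n as [|n IH]; [now rewrite !rsum_O|]. rewrite !rsum_S, IH; rring.
Qed.

Lemma rsum_const (c : R) n : sum_n (fun _ => c) n = INR (S n) * c.
Proof.
  induction n as [|n IH]; [rewrite rsum_O; simpl; rring|].
  rewrite rsum_S, IH, (S_INR (S n)); rring.
Qed.

Lemma rsum_term_le (a : nat -> R) n k : (k <= n)%nat ->
  (forall i, (i <= n)%nat -> 0 <= a i) -> a k <= sum_n a n.
Proof.
  induction n as [|n IH]; intros Hk H.
  - rewrite rsum_O; replace k with O by lia; lra.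
  - rewrite rsum_S. assert (H0 := H (S n) (Nat.le_refl _)).
    assert (Hs : 0 <= sum_n a n).
    { eapply Rle_trans; [apply (H O); lia|].
      clear -H; induction n as [|n IH]; [rewrite rsum_O; lra|].
      rewrite rsum_S; assert (0 <= a (S n)) by (apply H; lia).
      specialize (IH ltac:(intros; apply H; lia)); lra. }
    destruct (Nat.eq_dec k (S n)) as [->|ne]; [lra|].
    specialize (IH ltac:(lia) ltac:(intros; apply H; lia)); lra.
Qed.

(** * Polynomials in one and two variables *)

Lemma poly1_ext d (P Q : C -> C) :
  (forall z, P z = Q z) -> poly1_deg_le d P -> poly1_deg_le d Q.
Proof. intros H [a Ha]; exists a; intros z; rewrite <- H; apply Ha. Qed.

Lemma poly1_const d (c : C) : poly1_deg_le d (fun _ => c).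
Proof.
  exists (fun k => match k with O => c | _ => 0%C end); intros z.
  rewrite (csum_single _ _ 0) by (try lia; intros [|k]; try easy; intros; cring).
  simpl; cring.
Qed.

Lemma poly1_plus d (P Q : C -> C) : poly1_deg_le d P -> poly1_deg_le d Q ->
  poly1_deg_le d (fun z => (P z + Q z)%C).
Proof.
  intros [a Ha] [b Hb]; exists (fun k => (a k + b k)%C); intros z.
  rewrite Ha, Hb, <- csum_plus; apply csum_ext; intros; cring.
Qed.

Lemma poly1_scal d (c : C) (P : C -> C) : poly1_deg_le d P ->
  poly1_deg_le d (fun z => (c * P z)%C).
Proof.
  intros [a Ha]; exists (fun k => (c * a k)%C); intros z.
  rewrite Ha, <- csum_mult_l; apply csum_ext; intros; cring.
Qed.

Lemma poly1_S d (P : C -> C) : poly1_deg_le d P -> poly1_deg_le (S d) P.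
Proof.
  intros [a Ha]; exists (fun k => if Nat.leb k d then a k else 0%C); intros z.
  rewrite csum_S, (Ha z).
  replace (Nat.leb (S d) d) with false by (symmetry; apply Nat.leb_gt; lia).
  rewrite Cmult_0_l, Cplus_0_r; apply csum_ext; intros k Hk.
  now replace (Nat.leb k d) with true by (symmetry; apply Nat.leb_le; lia).
Qed.

Lemma poly1_le d d' (P : C -> C) : (d <= d')%nat ->
  poly1_deg_le d P -> poly1_deg_le d' P.
Proof. induction 1; auto; intros; apply poly1_S; auto. Qed.

Lemma poly1_X d (P : C -> C) : poly1_deg_le d P ->
  poly1_deg_le (S d) (fun z => (z * P z)%C).
Proof.
  intros [a Ha]; exists (fun k => match k with O => RtoC 0 | S k => a k end).
  intros z; rewrite Ha; clear Ha.
  induction d as [|d IH].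
  - rewrite csum_S, !csum_O; simpl; cring.
  - rewrite (csum_S _ (S d)), <- IH, csum_S, Cmult_plus_distr_l; simpl; cring.
Qed.

Lemma poly1_sum d (P : nat -> C -> C) n :
  (forall k, (k <= n)%nat -> poly1_deg_le d (P k)) ->
  poly1_deg_le d (fun z => sum_n (fun k => P k z) n).
Proof.
  induction n as [|n IH]; intros H.
  - apply poly1_ext with (2 := H O (Nat.le_refl _)); intros; now rewrite csum_O.
  - apply poly1_ext with (P := fun z => (sum_n (fun k => P k z) n + P (S n) z)%C).
    + intros; now rewrite csum_S.
    + apply poly1_plus; [apply IH; intros; apply H|apply H]; lia.
Qed.

Lemma poly1_monomial n d (P : C -> C) : poly1_deg_le d P ->
  poly1_deg_le (n + d) (fun z => (Cpow z n * P z)%C).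
Proof.
  intros H; induction n as [|n IH].
  - apply poly1_ext with (2 := H); intros; simpl; cring.
  - apply poly1_X in IH; apply poly1_ext with (2 := IH); intros; simpl; cring.
Qed.

Lemma poly1_mult d e (P Q : C -> C) : poly1_deg_le d P -> poly1_deg_le e Q ->
  poly1_deg_le (d + e) (fun z => (P z * Q z)%C).
Proof.
  intros [a Ha] HQ.
  apply poly1_ext with (P := fun z => sum_n (fun k => (a k * (Cpow z k * Q z))%C) d).
  - intros z; rewrite Ha, Cmult_comm, <- csum_mult_l; apply csum_ext; intros; cring.
  - apply poly1_sum; intros k Hk; apply poly1_scal.
    apply poly1_le with (k + e)%nat; [lia|now apply poly1_monomial].
Qed.

Lemma poly1_pow d k (P : C -> C) : poly1_deg_le d P ->
  poly1_deg_le (k * d) (fun z => Cpow (P z) k).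
Proof.
  intros H; induction k as [|k IH]; [apply (poly1_const _ 1)|].
  simpl; now apply poly1_mult.
Qed.

Lemma poly1_linear (a : C) : poly1_deg_le 1 (fun z => (z + a)%C).
Proof.
  exists (fun k => match k with O => a | _ => 1%C end); intros z.
  rewrite csum_S, csum_O; simpl; cring.
Qed.

Lemma poly2_ext d (P Q : C -> C -> C) :
  (forall z1 z2, P z1 z2 = Q z1 z2) -> poly2_deg_le d P -> poly2_deg_le d Q.
Proof. intros H [a Ha]; exists a; intros; rewrite <- H; apply Ha. Qed.

Lemma poly2_plus d (P Q : C -> C -> C) : poly2_deg_le d P -> poly2_deg_le d Q ->
  poly2_deg_le d (fun z1 z2 => (P z1 z2 + Q z1 z2)%C).
Proof.
  intros [a Ha] [b Hb]; exists (fun k l => (a k l + b k l)%C); intros z1 z2.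
  rewrite Ha, Hb, <- csum_plus; apply csum_ext; intros; unfold homog_part.
  rewrite <- csum_plus; apply csum_ext; intros; cring.
Qed.

Lemma poly2_scal d (c : C) (P : C -> C -> C) : poly2_deg_le d P ->
  poly2_deg_le d (fun z1 z2 => (c * P z1 z2)%C).
Proof.
  intros [a Ha]; exists (fun k l => (c * a k l)%C); intros z1 z2.
  rewrite Ha, <- csum_mult_l; apply csum_ext; intros; unfold homog_part.
  rewrite <- csum_mult_l; apply csum_ext; intros; cring.
Qed.

Lemma poly2_monomial d i j : (i + j <= d)%nat ->
  poly2_deg_le d (fun z1 z2 => (Cpow z1 i * Cpow z2 j)%C).
Proof.
  intros H.
  exists (fun k l => if andb (Nat.eqb k i) (Nat.eqb l j) then 1%C else 0%C).
  intros z1 z2; rewrite (csum_single _ _ (i + j)); [|lia|].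
  - unfold homog_part; rewrite (csum_single _ _ j); [|lia|].
    + replace (i + j - j)%nat with i by lia; rewrite !Nat.eqb_refl; simpl; cring.
    + intros k _ ne; apply Nat.eqb_neq in ne; rewrite ne, Bool.andb_false_r; cring.
  - intros n _ ne; unfold homog_part; apply csum_zero; intros k Hk.
    destruct (Nat.eqb_spec (n - k) i); destruct (Nat.eqb_spec k j); simpl;
      try cring; lia.
Qed.

Lemma poly2_zero d : poly2_deg_le d (fun _ _ => 0%C).
Proof.
  exists (fun _ _ => 0%C); intros; rewrite csum_zero; auto; intros.
  apply csum_zero; intros; cring.
Qed.

Lemma poly2_monomial_poly1 d i e (Q : C -> C) : (i + e <= d)%nat ->
  poly1_deg_le e Q -> poly2_deg_le d (fun z1 z2 => (Cpow z1 i * Q z2)%C).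
Proof.
  intros Hd [a Ha].
  apply poly2_ext with
    (P := fun z1 z2 => sum_n (fun k => (a k * (Cpow z1 i * Cpow z2 k))%C) e).
  { intros; rewrite Ha, <- csum_mult_l; apply csum_ext; intros; cring. }
  clear Ha. induction e as [|e IH].
  - apply poly2_ext with (P := fun z1 z2 => (a O * (Cpow z1 i * Cpow z2 0))%C).
    + intros; now rewrite csum_O.
    + apply poly2_scal, poly2_monomial; lia.
  - apply poly2_ext with (P := fun z1 z2 =>
      (sum_n (fun k => (a k * (Cpow z1 i * Cpow z2 k))%C) e
       + a (S e) * (Cpow z1 i * Cpow z2 (S e)))%C).
    + intros; now rewrite csum_S.
    + apply poly2_plus; [apply IH; lia|apply poly2_scal, poly2_monomial; lia].
Qed.

(** The degree is bounded in each variable separately.  Being inductive, the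
    definition lets statements that are linear in the polynomial be proved on
    products [z1 ^ i * Q z2] alone. *)
Inductive bipoly (q : nat) : (C -> C -> C) -> Prop :=
| bipoly_mono i Q : (i <= q)%nat -> poly1_deg_le q Q ->
    bipoly q (fun z1 z2 => (Cpow z1 i * Q z2)%C)
| bipoly_plus P Q : bipoly q P -> bipoly q Q ->
    bipoly q (fun z1 z2 => (P z1 z2 + Q z1 z2)%C)
| bipoly_ext P Q : (forall z1 z2, P z1 z2 = Q z1 z2) -> bipoly q P -> bipoly q Q.

Lemma bipoly_prod q (A B : C -> C) : poly1_deg_le q A -> poly1_deg_le q B ->
  bipoly q (fun z1 z2 => (A z1 * B z2)%C).
Proof.
  intros [a Ha] HB.
  apply bipoly_ext with
    (P := fun z1 z2 => sum_n (fun k => (Cpow z1 k * (a k * B z2))%C) q).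
  { intros; rewrite Ha, Cmult_comm, <- csum_mult_l; apply csum_ext; intros; cring. }
  clear Ha. assert (H : forall n, (n <= q)%nat -> bipoly q
    (fun z1 z2 => sum_n (fun k => (Cpow z1 k * (a k * B z2))%C) n)).
  2: apply H; lia.
  induction n as [|n IH]; intros Hn.
  - apply bipoly_ext with (P := fun z1 z2 => (Cpow z1 0 * (a O * B z2))%C).
    + intros; now rewrite csum_O.
    + apply bipoly_mono with (Q := fun z2 => (a O * B z2)%C); [lia|].
      now apply poly1_scal.
  - apply bipoly_ext with (P := fun z1 z2 =>
      (sum_n (fun k => (Cpow z1 k * (a k * B z2))%C) n
       + Cpow z1 (S n) * (a (S n) * B z2))%C).
    + intros; now rewrite csum_S.
    + apply bipoly_plus; [apply IH; lia|].
      apply bipoly_mono with (Q := fun z2 => (a (S n) * B z2)%C); [lia|].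
      now apply poly1_scal.
Qed.

Lemma bipoly_sum q (P : nat -> C -> C -> C) n :
  (forall k, (k <= n)%nat -> bipoly q (P k)) ->
  bipoly q (fun z1 z2 => sum_n (fun k => P k z1 z2) n).
Proof.
  induction n as [|n IH]; intros H.
  - apply bipoly_ext with (2 := H O (Nat.le_refl _)); intros; now rewrite csum_O.
  - apply bipoly_ext with
      (P := fun z1 z2 => (sum_n (fun k => P k z1 z2) n + P (S n) z1 z2)%C).
    + intros; now rewrite csum_S.
    + apply bipoly_plus; [apply IH; intros; apply H|apply H]; lia.
Qed.

Lemma bipoly_freeze q (P : C -> C -> C) (c : C) : bipoly q P -> bipoly q (fun _ z2 => P c z2).
Proof.
  intros H. assert (H1 : poly1_deg_le q (fun z2 => P c z2)).
  { induction H as [i Q Hi HQ|P Q _ IHP _ IHQ|P Q HPQ _ IH].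
    - now apply poly1_scal.
    - now apply poly1_plus.
    - apply poly1_ext with (2 := IH); intros; apply HPQ. }
  apply bipoly_ext with (P := fun z1 z2 => (Cpow z1 0 * P c z2)%C).
  - intros; simpl; cring.
  - apply bipoly_mono with (Q := fun z2 => P c z2); auto; lia.
Qed.

(** * Rational functions with prescribed simple poles *)

Section PartialFractions.

Variable b : nat -> R.
Hypothesis b_pos : forall i, 0 < b i.
Hypothesis b_inj : forall i j, b i = b j -> i = j.

Fixpoint denom (n : nat) (x : R) : R :=
  match n with O => 1 | S n => denom n x * (x + b n) end.

Lemma denom_pos n x : 0 <= x -> 0 < denom n x.
Proof.
  intros Hx; induction n as [|n IH]; simpl; [lra|].
  apply Rmult_lt_0_compat; auto; specialize (b_pos n); lra.
Qed.

(** A linear span, described inductively so that no coefficient of a partial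
    fraction decomposition ever has to be written down. *)
Inductive simple_fractions (n q : nat) : (R -> R) -> Prop :=
| sf_pole j : (j < n)%nat -> simple_fractions n q (fun x => / (x + b j))
| sf_mono t : (t <= q)%nat -> simple_fractions n q (fun x => x ^ t)
| sf_plus u v : simple_fractions n q u -> simple_fractions n q v ->
    simple_fractions n q (fun x => u x + v x)
| sf_scal c u : simple_fractions n q u -> simple_fractions n q (fun x => c * u x)
| sf_ext u v : (forall x, 0 < x -> u x = v x) ->
    simple_fractions n q u -> simple_fractions n q v.

Lemma sf_S n q u : simple_fractions n q u -> simple_fractions (S n) q u.
Proof.
  induction 1; [apply sf_pole; lia|now apply sf_mono|now apply sf_plus
    |now apply sf_scal|now apply sf_ext with u].
Qed.

(** Distinctness of the poles enters through
    [1 / ((x + b j) (x + b n)) = (1 / (x + b j) - 1 / (x + b n)) / (b n - b j)]. *)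
Lemma sf_div n q u : simple_fractions n q u ->
  simple_fractions (S n) q (fun x => u x / (x + b n)).
Proof.
  assert (Hp := b_pos n).
  induction 1 as [j Hj|t Ht|u v _ IHu _ IHv|c u _ IHu|u v Huv _ IHu].
  - assert (Hne : b n - b j <> 0).
    { intros E; assert (n = j) by (apply b_inj; lra); lia. }
    assert (Hq := b_pos j).
    apply sf_ext with
      (u := fun x => / (b n - b j) * (/ (x + b j) + -1 * / (x + b n))).
    + intros x Hx; field; lra.
    + apply sf_scal, sf_plus; [|apply sf_scal]; apply sf_pole; lia.
  - induction t as [|t IH].
    + apply sf_ext with (u := fun x => / (x + b n)).
      * intros; simpl; field; lra.
      * apply sf_pole; lia.
    + apply sf_ext with (u := fun x => x ^ t + - b n * (x ^ t / (x + b n))).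
      * intros; simpl; field; lra.
      * apply sf_plus; [apply sf_mono; lia|apply sf_scal, IH; lia].
  - eapply sf_ext; [|apply sf_plus; [exact IHu|exact IHv]].
    intros; simpl; field; lra.
  - eapply sf_ext; [|apply (sf_scal _ _ c), IHu]. intros; simpl; field; lra.
  - eapply sf_ext; [|exact IHu]. intros; simpl; now rewrite Huv.
Qed.

(** The poles are added one at a time.  Each step divides by [x + b n] or multiplies
    by [x / (x + b n) = 1 - b n / (x + b n)], and neither raises the degree of the
    polynomial part, which is how [K] may exceed [q] by the number of poles. *)
Lemma sf_power_over_denom n q K : (K <= n + q)%nat ->
  simple_fractions n q (fun x => x ^ K / denom n x).
Proof.
  revert K; induction n as [|n IH]; intros K HK.
  - apply sf_ext with (u := fun x => x ^ K); [intros; simpl; field; lra|now apply sf_mono].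
  - assert (Hp := b_pos n). destruct (Nat.le_gt_cases K (n + q)) as [H|H].
    + eapply sf_ext; [|apply sf_div, (IH K H)].
      intros x Hx; assert (H1 := denom_pos n x ltac:(lra)); simpl; field; lra.
    + destruct K as [|K]; [lia|].
      eapply sf_ext; [|apply sf_plus;
        [apply sf_S, (IH K)|apply (sf_scal _ _ (- b n)), sf_div, (IH K)]; lia].
      intros x Hx; assert (H1 := denom_pos n x ltac:(lra)); simpl; field; lra.
Qed.

Definition has_rational_form (n d : nat) (g : R -> R -> C) : Prop :=
  exists (s : nat -> C -> C) (p : C -> C -> C),
    (forall j, poly1_deg_le d (s j)) /\ poly2_deg_le d p /\
    forall x y, 0 < x ->
      g x y = rational_form n (fun j => - b j) s p (RtoC x) (RtoC y).

Lemma hrf_plus n d g h : has_rational_form n d g -> has_rational_form n d h ->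
  has_rational_form n d (fun x y => (g x y + h x y)%C).
Proof.
  intros [s [p [Hs [Hp E]]]] [s' [p' [Hs' [Hp' E']]]].
  exists (fun j z => (s j z + s' j z)%C), (fun z1 z2 => (p z1 z2 + p' z1 z2)%C).
  split; [intros; now apply poly1_plus|split; [now apply poly2_plus|]].
  intros x y Hx; rewrite E, E' by auto; unfold rational_form.
  rewrite (csum_ext (fun j => ((s j y + s' j y) / (x - (- b j)%R))%C)
    (fun j => (s j y / (x - (- b j)%R) + s' j y / (x - (- b j)%R))%C) (n - 1)).
  - rewrite csum_plus; cring.
  - intros; unfold Cdiv; cring.
Qed.

Lemma hrf_scal n d c g : has_rational_form n d g ->
  has_rational_form n d (fun x y => (c * g x y)%C).
Proof.
  intros [s [p [Hs [Hp E]]]].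
  exists (fun j z => (c * s j z)%C), (fun z1 z2 => (c * p z1 z2)%C).
  split; [intros; now apply poly1_scal|split; [now apply poly2_scal|]].
  intros x y Hx; rewrite E by auto; unfold rational_form.
  rewrite (csum_ext (fun j => (c * s j y / (x - (- b j)%R))%C)
    (fun j => (c * (s j y / (x - (- b j)%R)))%C) (n - 1)).
  - rewrite csum_mult_l; cring.
  - intros; unfold Cdiv; cring.
Qed.

Lemma hrf_ext n d g h : (forall x y, 0 < x -> g x y = h x y) ->
  has_rational_form n d g -> has_rational_form n d h.
Proof.
  intros H [s [p [Hs [Hp E]]]]; exists s, p; repeat split; auto.
  intros x y Hx; rewrite <- H; auto.
Qed.

Lemma hrf_sum n d (g : nat -> R -> R -> C) N :
  (forall k, (k <= N)%nat -> has_rational_form n d (g k)) ->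
  has_rational_form n d (fun x y => sum_n (fun k => g k x y) N).
Proof.
  induction N as [|N IH]; intros H.
  - apply hrf_ext with (2 := H O (Nat.le_refl _)); intros; now rewrite csum_O.
  - apply hrf_ext with
      (g := fun x y => (sum_n (fun k => g k x y) N + g (S N) x y)%C).
    + intros; now rewrite csum_S.
    + apply hrf_plus; [apply IH; intros; apply H|apply H]; lia.
Qed.

Lemma hrf_simple_fractions n q e d u Q : simple_fractions n q u ->
  poly1_deg_le e Q -> (q + e <= d)%nat ->
  has_rational_form n d (fun x y => (RtoC (u x) * Q (RtoC y))%C).
Proof.
  intros Hu HQ Hd.
  induction Hu as [j Hj|t Ht|u v _ IHu _ IHv|c u _ IHu|u v Huv _ IHu].
  - exists (fun i => if Nat.eq_dec i j then Q else fun _ => 0%C), (fun _ _ => 0%C).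
    split; [|split; [apply poly2_zero|]].
    + intros i; destruct (Nat.eq_dec i j); [|apply poly1_const].
      apply poly1_le with e; auto; lia.
    + intros x y Hx; assert (Hq := b_pos j); unfold rational_form.
      rewrite (csum_single _ _ j); [|lia|].
      * destruct (Nat.eq_dec j j) as [_|]; [|easy].
        rewrite RtoC_inv by lra. rewrite RtoC_plus, RtoC_opp. field.
        rewrite <- RtoC_opp, <- RtoC_minus; intros E; apply RtoC_inj in E; lra.
      * intros k _ ne; destruct (Nat.eq_dec k j) as [->|_]; [easy|].
        unfold Cdiv; cring.
  - exists (fun _ _ => 0%C), (fun z1 z2 => (Cpow z1 t * Q z2)%C).
    split; [intros; apply poly1_const|split].
    + apply poly2_monomial_poly1 with e; auto; lia.
    + intros x y Hx; unfold rational_form; rewrite csum_zero, RtoC_pow; [cring|].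
      intros; unfold Cdiv; cring.
  - eapply hrf_ext; [|apply hrf_plus; [exact IHu|exact IHv]].
    intros; simpl; rewrite RtoC_plus; cring.
  - eapply hrf_ext; [|apply (hrf_scal _ _ (RtoC c)), IHu].
    intros; simpl; rewrite RtoC_mult; cring.
  - eapply hrf_ext; [|exact IHu]. intros; simpl; now rewrite Huv.
Qed.

(** The factor [x ^ i] of a monomial of [T] is absorbed by the numerator [x ^ k], so
    that the polynomial part has degree at most [q] in [x]. *)
Lemma hrf_weight_bipoly n q e d k T Q : (k <= n)%nat -> bipoly q T ->
  poly1_deg_le e Q -> (q + (q + e) <= d)%nat ->
  has_rational_form n d
    (fun x y => (RtoC (x ^ k / denom n x) * Q (RtoC y) * T (RtoC x) (RtoC y))%C).
Proof.
  intros Hk HT HQ Hd.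
  induction HT as [i A Hi HA|T U _ IHT _ IHU|T U HTU _ IH].
  - eapply hrf_ext; [|apply (hrf_simple_fractions n q (q + e) d
      (fun x => x ^ (k + i) / denom n x) (fun z => (A z * Q z)%C))].
    + intros x y Hx; simpl. rewrite pow_add.
      unfold Rdiv; rewrite !RtoC_mult, (RtoC_pow _ i); cring.
    + apply sf_power_over_denom; lia.
    + now apply poly1_mult.
    + lia.
  - eapply hrf_ext; [|apply hrf_plus; [exact IHT|exact IHU]].
    intros; simpl; cring.
  - eapply hrf_ext; [|exact IH]. intros; simpl; now rewrite HTU.
Qed.

End PartialFractions.

(** * The rational partition of unity *)

Lemma two_sqrt_le x c : 0 < x -> 0 < c -> 2 * sqrt (x * c) <= x + c.
Proof.
  intros Hx Hc; rewrite sqrt_mult by lra.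
  assert (Hx' := sqrt_sqrt x ltac:(lra)); assert (Hc' := sqrt_sqrt c ltac:(lra)).
  assert (H := Rle_0_sqr (sqrt x - sqrt c)); unfold Rsqr in H. lra.
Qed.

Section Weights.

Variable b : nat -> R.
Hypothesis b_pos : forall i, 0 < b i.

Fixpoint prodn (F : nat -> R) (n : nat) : R :=
  match n with O => 1 | S n => prodn F n * F n end.

(** The coefficient of [x ^ k] in [denom b n x], that is the elementary symmetric
    polynomial of degree [n - k] in the first [n] of the [b i]. *)
Fixpoint ecoef (n k : nat) : R :=
  match n with
  | O => match k with O => 1 | _ => 0 end
  | S n => b n * ecoef n k + match k with O => 0 | S k => ecoef n k end
  end.

(** The probability of [k] failures in [n] independent trials whose success
    probabilities are [b i / (x + b i)]: a rational analogue of the Bernstein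
    polynomials.  Letting the [b i] differ is what keeps the poles simple. *)
Definition weight (n k : nat) (x : R) : R := ecoef n k * (x ^ k / denom b n x).

Lemma ecoef_zero n k : (n < k)%nat -> ecoef n k = 0.
Proof.
  revert k; induction n as [|n IH]; intros [|k] H; simpl; try lia; auto.
  rewrite !IH by lia; ring.
Qed.

Lemma ecoef_ge0 n k : 0 <= ecoef n k.
Proof.
  revert k; induction n as [|n IH]; intros [|k]; simpl; try lra;
    assert (H := b_pos n); assert (H0 := IH O).
  - nra.
  - assert (H1 := IH k); assert (H2 := IH (S k)); nra.
Qed.

Lemma ecoef_pos n k : (k <= n)%nat -> 0 < ecoef n k.
Proof.
  revert k; induction n as [|n IH]; intros [|k] Hk; simpl; try lra; try lia;
    assert (H := b_pos n).
  - assert (H0 := IH O ltac:(lia)); nra.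
  - assert (H1 := IH k ltac:(lia)); assert (H2 := ecoef_ge0 n (S k)); nra.
Qed.

Lemma ecoef_sum n x : sum_n (fun k => ecoef n k * x ^ k) n = denom b n x.
Proof.
  induction n as [|n IH]; [rewrite rsum_O; simpl; rring|].
  assert (H : forall N, sum_n (fun k => ecoef (S n) k * x ^ k) (S N)
    = b n * sum_n (fun k => ecoef n k * x ^ k) (S N)
      + x * sum_n (fun k => ecoef n k * x ^ k) N).
  { induction N as [|N IHN].
    - rewrite !rsum_S, !rsum_O; simpl; rring.
    - rewrite (rsum_S _ (S N)), IHN, !(rsum_S _ (S N)), (rsum_S _ N); simpl; rring. }
  rewrite H, rsum_S, ecoef_zero, IH by lia; simpl; rring.
Qed.

Lemma weight_ge0 n k x : 0 <= x -> 0 <= weight n k x.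
Proof.
  intros Hx; assert (H := denom_pos b b_pos n x Hx).
  apply Rmult_le_pos; [apply ecoef_ge0|].
  apply Rmult_le_pos; [now apply pow_le|]. apply Rlt_le, Rinv_0_lt_compat, H.
Qed.

Lemma weight_pos n k x : (k <= n)%nat -> 0 < x -> 0 < weight n k x.
Proof.
  intros Hk Hx; assert (H := denom_pos b b_pos n x ltac:(lra)).
  apply Rmult_lt_0_compat; [now apply ecoef_pos|].
  apply Rmult_lt_0_compat; [now apply pow_lt|]. apply Rinv_0_lt_compat, H.
Qed.

Lemma weight_sum n x : 0 <= x -> sum_n (fun k => weight n k x) n = 1.
Proof.
  intros Hx; assert (H := denom_pos b b_pos n x Hx).
  rewrite (rsum_ext _ (fun k => / denom b n x * (ecoef n k * x ^ k))).
  - rewrite rsum_mult_l, ecoef_sum; match goal with |- @eq _ ?a ?b => change (@eq R a b) end; field; lra.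
  - intros; unfold weight; match goal with |- @eq _ ?a ?b => change (@eq R a b) end; field; lra.
Qed.

Lemma weight_le1 n k x : (k <= n)%nat -> 0 <= x -> weight n k x <= 1.
Proof.
  intros Hk Hx; rewrite <- (weight_sum n x Hx).
  apply (rsum_term_le (fun k => weight n k x)); auto using weight_ge0.
Qed.

Lemma continuity_weight n k x : 0 <= x -> continuity_pt (weight n k) x.
Proof.
  intros Hx. assert (Hd : forall m, continuity_pt (denom b m) x).
  { induction m as [|m IH].
    - apply continuity_pt_const; intros u v; reflexivity.
    - apply (continuity_pt_mult (denom b m) (fun x => x + b m)); auto; reg. }
  apply (continuity_pt_mult (fun _ => ecoef n k) (fun x => x ^ k / denom b n x)).
  - apply continuity_pt_const; intros u v; reflexivity.
  - apply (continuity_pt_div (fun x => x ^ k)); auto.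
    + apply derivable_continuous_pt, derivable_pt_pow.
    + assert (H := denom_pos b b_pos n x Hx); lra.
Qed.

Lemma weight_peak n k : (k <= n)%nat -> exists c, 0 <= c <= 1 /\
  0 < weight n k c /\ forall u, 0 <= u <= 1 -> weight n k u <= weight n k c.
Proof.
  intros Hk. destruct (continuity_ab_maj (weight n k) 0 1) as [c [Hc Hc1]]; [lra| |].
  - intros u Hu; apply continuity_weight; lra.
  - exists c; split; [auto|split; [|auto]].
    apply Rlt_le_trans with (weight n k 1); [apply weight_pos; auto; lra|apply Hc; lra].
Qed.

Lemma prodn_ge1 F n : (forall i, (i < n)%nat -> 1 <= F i) -> 1 <= prodn F n.
Proof.
  induction n as [|n IH]; simpl; intros H; [lra|].
  assert (H1 := H n ltac:(lia)); assert (H2 := IH ltac:(intros; apply H; lia)); nra.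
Qed.

Lemma prodn_block F n i0 m B : (i0 + m <= n)%nat -> 1 <= B ->
  (forall i, (i < n)%nat -> 1 <= F i) ->
  (forall i, (i0 <= i < i0 + m)%nat -> B <= F i) -> B ^ m <= prodn F n.
Proof.
  intros Hn HB H1 H2; induction n as [|n IH].
  - replace m with O by lia; simpl; lra.
  - simpl. assert (Hn1 := H1 n ltac:(lia)).
    destruct (Nat.le_gt_cases (i0 + m) n) as [H|H].
    + specialize (IH H ltac:(intros; apply H1; lia)).
      assert (0 < B ^ m) by (apply pow_lt; lra). nra.
    + clear IH. replace n with (i0 + m - 1)%nat in * by lia.
      assert (Hm : forall m', (i0 + m' <= i0 + m)%nat -> B ^ m' <= prodn F (i0 + m')).
      { induction m' as [|m' IH]; intros Hm'.
        - simpl; apply prodn_ge1; intros; apply H1; lia.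
        - rewrite Nat.add_succ_r; simpl.
          specialize (IH ltac:(lia)); specialize (H2 (i0 + m')%nat ltac:(lia)).
          assert (0 < B ^ m') by (apply pow_lt; lra). nra. }
      destruct m as [|m].
      { simpl. assert (1 <= prodn F (i0 + 0 - 1)).
        { apply prodn_ge1; intros; apply H1; lia. } nra. }
      specialize (Hm (S m) ltac:(lia)).
      replace (i0 + S m)%nat with (S (i0 + S m - 1)) in Hm at 1 by lia.
      exact Hm.
Qed.

(** This is log-concavity of the weights in the variable [log x].  Because
    [x * c = z * v], the numerators [x ^ k] cancel and only the factors [x + b i]
    of the denominators are compared. *)
Lemma weight_four_points n k x c z v F :
  0 <= x -> 0 <= c -> 0 <= z -> 0 <= v -> x * c = z * v ->
  (forall i, 0 <= F i) ->
  (forall i, (z + b i) * (v + b i) * F i <= (x + b i) * (c + b i)) ->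
  weight n k x * weight n k c * prodn F n <= weight n k z * weight n k v.
Proof.
  intros Hx Hc Hz Hv E HF H.
  assert (Px := denom_pos b b_pos n x Hx); assert (Pc := denom_pos b b_pos n c Hc).
  assert (Pz := denom_pos b b_pos n z Hz); assert (Pv := denom_pos b b_pos n v Hv).
  assert (HP : denom b n z * denom b n v * prodn F n <= denom b n x * denom b n c
    /\ 0 <= prodn F n).
  { clear Px Pc Pz Pv; induction n as [|n IH]; simpl; [lra|].
    destruct IH as [IH IH0].
    assert (Px := denom_pos b b_pos n x Hx); assert (Pc := denom_pos b b_pos n c Hc).
    assert (Pz := denom_pos b b_pos n z Hz); assert (Pv := denom_pos b b_pos n v Hv).
    specialize (HF n); specialize (H n); assert (Hb := b_pos n).
    split; [|now apply Rmult_le_pos].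
    replace (denom b n z * (z + b n) * (denom b n v * (v + b n)) * (prodn F n * F n))
      with ((denom b n z * denom b n v * prodn F n) * ((z + b n) * (v + b n) * F n))
      by ring.
    replace (denom b n x * (x + b n) * (denom b n c * (c + b n)))
      with ((denom b n x * denom b n c) * ((x + b n) * (c + b n))) by ring.
    apply Rmult_le_compat; auto.
    - apply Rmult_le_pos; auto; apply Rlt_le; nra.
    - apply Rmult_le_pos; auto; apply Rlt_le; nra. }
  destruct HP as [HP _].
  unfold weight.
  replace (ecoef n k * (x ^ k / denom b n x) * (ecoef n k * (c ^ k / denom b n c)) * prodn F n)
    with ((ecoef n k) ^ 2 * (x * c) ^ k * (prodn F n / (denom b n x * denom b n c)))
    by (rewrite Rpow_mult_distr; field; lra).
  replace (ecoef n k * (z ^ k / denom b n z) * (ecoef n k * (v ^ k / denom b n v)))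
    with ((ecoef n k) ^ 2 * (x * c) ^ k * / (denom b n z * denom b n v))
    by (rewrite E, Rpow_mult_distr; field; lra).
  apply Rmult_le_compat_l.
  - apply Rmult_le_pos; [apply pow2_ge_0|apply pow_le; now apply Rmult_le_pos].
  - apply Rmult_le_reg_r with (denom b n x * denom b n c); [nra|].
    unfold Rdiv; rewrite Rmult_assoc, Rinv_l, Rmult_1_r by nra.
    apply Rmult_le_reg_l with (denom b n z * denom b n v); [nra|].
    rewrite <- Rmult_assoc, <- Rmult_assoc, Rinv_r, Rmult_1_l by nra. exact HP.
Qed.

Section Peak.

Variables (n k : nat) (c : R).
Hypothesis c_range : 0 <= c <= 1.
Hypothesis c_pos : 0 < weight n k c.
Hypothesis c_max : forall u, 0 <= u <= 1 -> weight n k u <= weight n k c.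

(** With [v = x * c / z] the four points [x, c] and [z, v] have the same product,
    and [z, v] lie between [x] and [c]. *)
Lemma weight_unimodal x z : 0 <= x <= 1 -> 0 < z ->
  (x <= z <= c \/ c <= z <= x) -> weight n k x <= weight n k z.
Proof.
  intros Hx Hz H.
  assert (Hv : 0 <= x * c / z <= 1).
  { split.
    - apply Rmult_le_pos; [nra|apply Rlt_le, Rinv_0_lt_compat; lra].
    - apply Rmult_le_reg_r with z; auto. unfold Rdiv.
      rewrite Rmult_assoc, Rinv_l by lra. nra. }
  assert (E : x * c = z * (x * c / z)) by (field; lra).
  assert (D : weight n k x * weight n k c * prodn (fun _ => 1) n
    <= weight n k z * weight n k (x * c / z)).
  { apply weight_four_points; try lra; [intros; lra|].
    intros i; assert (Hb := b_pos i).
    set (v := x * c / z) in *.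
    assert (z + v <= x + c).
    { apply Rmult_le_reg_l with z; auto. nra. }
    nra. }
  assert (P1 : 1 <= prodn (fun _ => 1) n) by (apply prodn_ge1; intros; lra).
  assert (Wx := weight_ge0 n k x ltac:(lra)).
  assert (Wz := weight_ge0 n k z ltac:(lra)).
  assert (Wv := c_max _ Hv).
  apply Rmult_le_reg_r with (weight n k c); auto.
  apply Rle_trans with (weight n k x * weight n k c * prodn (fun _ => 1) n).
  - rewrite <- (Rmult_1_r (weight n k x * weight n k c)) at 1.
    apply Rmult_le_compat_l; auto; apply Rmult_le_pos; lra.
  - apply Rle_trans with (1 := D); now apply Rmult_le_compat_l.
Qed.

End Peak.

(** The quotient is [sqrt (x / c) + sqrt (c / x) - 2], so this is 1 at [x = c] and of
    the order of [sqrt (x / c)] for large [x / c].  The constant [4 / 25] is the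
    minimum of [g b / (g + b) ^ 2] for [g / 4 <= b <= g]. *)
Definition growth (x c : R) : R := 1 + 4 / 25 * ((x + c - 2 * sqrt (x * c)) / sqrt (x * c)).

(** Log-concavity at the geometric mean [g] of [x] and [c]: since
    [(x + b) (c + b) = (g + b) ^ 2 (1 + b (x + c - 2 g) / (g + b) ^ 2)], every pole
    between [g / 4] and [g] contributes a factor [growth x c] to the decay of the
    weight from [c] to [x]. *)
Lemma weight_decay n k x c i0 m : (k <= n)%nat -> 0 < x -> 0 < c ->
  weight n k (sqrt (x * c)) <= weight n k c ->
  (i0 + m <= n)%nat ->
  (forall i, (i0 <= i < i0 + m)%nat -> sqrt (x * c) / 4 <= b i <= sqrt (x * c)) ->
  weight n k x * growth x c ^ m <= 1.
Proof.
  intros Hk Hx Hc Hg Hm Hb.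
  set (g := sqrt (x * c)) in *.
  assert (Hg0 : 0 < g) by (apply sqrt_lt_R0; nra).
  assert (Hgg : g * g = x * c) by (apply sqrt_sqrt; nra).
  assert (Hs : 0 <= x + c - 2 * g) by (assert (Hamgm := two_sqrt_le x c Hx Hc); unfold g; lra).
  assert (Hs' : 0 <= (x + c - 2 * g) / g)
    by (apply Rmult_le_pos; auto; apply Rlt_le, Rinv_0_lt_compat; auto).
  set (F := fun i => 1 + b i * (x + c - 2 * g) / ((g + b i) * (g + b i))).
  assert (HF : forall i, 1 <= F i).
  { intros i; unfold F; assert (H := b_pos i).
    assert (0 <= b i * (x + c - 2 * g) / ((g + b i) * (g + b i))); [|lra].
    apply Rmult_le_pos; [nra|apply Rlt_le, Rinv_0_lt_compat; nra]. }
  assert (D : weight n k x * weight n k c * prodn F n <= weight n k g * weight n k g).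
  { apply weight_four_points; try lra.
    - intros i; specialize (HF i); lra.
    - intros i; unfold F; assert (H := b_pos i); apply Req_le; field_simplify; [|lra].
      replace (g ^ 2) with (x * c) by (rewrite <- Hgg; ring). ring. }
  assert (HB : growth x c ^ m <= prodn F n).
  { apply prodn_block with i0; auto.
    - unfold growth; fold g; lra.
    - intros i Hi; specialize (Hb i Hi); assert (H := b_pos i).
      unfold growth, F; fold g.
      apply Rplus_le_compat_l.
      apply Rmult_le_reg_r with ((g + b i) * (g + b i)); [nra|].
      replace (b i * (x + c - 2 * g) / ((g + b i) * (g + b i)) * ((g + b i) * (g + b i)))
        with (b i * g * ((x + c - 2 * g) / g)) by (field; lra).
      assert (4 / 25 * ((g + b i) * (g + b i)) <= b i * g) by nra. nra. }
  assert (Wx := weight_ge0 n k x ltac:(lra)).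
  assert (Wg := weight_pos n k g Hk Hg0).
  assert (Wc := weight_pos n k c Hk Hc).
  assert (W1 := weight_le1 n k c Hk ltac:(lra)).
  apply Rle_trans with (weight n k x * prodn F n); [nra|].
  apply Rle_trans with (weight n k c); auto.
  apply Rmult_le_reg_r with (weight n k c); auto. nra.
Qed.

End Weights.

(** With [g = sqrt (x * c)] one has
    [(x + c - 2 g) / g = (x - c) ^ 2 / (g (x + c + 2 g)) >= ((x - c) / (x + c)) ^ 2]. *)
Lemma growth_far e x c : 0 < e <= 1 -> 0 < x -> 0 < c -> e * c < Rabs (x - c) ->
  1 + 4 / 225 * (e * e) <= growth x c.
Proof.
  intros He Hx Hc H. unfold growth.
  set (g := sqrt (x * c)) in *.
  assert (Hg0 : 0 < g) by (apply sqrt_lt_R0; nra).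
  assert (Hgg : g * g = x * c) by (apply sqrt_sqrt; nra).
  assert (Hs : 0 <= x + c - 2 * g) by (assert (Hamgm := two_sqrt_le x c Hx Hc); unfold g; lra).
  assert (H1 : e * (x + c) <= 3 * Rabs (x - c)).
  { revert H; unfold Rabs; destruct (Rcase_abs (x - c)); intros H; nra. }
  assert (H2 : e * e * ((x + c) * (x + c)) <= 9 * ((x - c) * (x - c))).
  { replace (9 * ((x - c) * (x - c))) with ((3 * Rabs (x - c)) * (3 * Rabs (x - c)))
      by (unfold Rabs; destruct (Rcase_abs (x - c)); ring).
    replace (e * e * ((x + c) * (x + c))) with ((e * (x + c)) * (e * (x + c))) by ring.
    apply Rmult_le_compat; nra. }
  assert (e * e / 9 <= (x + c - 2 * g) / g); [|lra].
  apply Rmult_le_reg_r with g; auto.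
  replace ((x + c - 2 * g) / g * g) with (x + c - 2 * g) by (field; lra).
  apply Rmult_le_reg_r with (x + c + 2 * g); [lra|].
  replace ((x + c - 2 * g) * (x + c + 2 * g)) with ((x - c) * (x - c)) by nra.
  apply Rle_trans with (e * e / 9 * ((x + c) * (x + c))); [|lra].
  rewrite Rmult_assoc; apply Rmult_le_compat_l; nra.
Qed.

Lemma growth_large x c : 0 < x -> 0 < c -> x / c <= 40 * (growth x c * growth x c).
Proof.
  intros Hx Hc. unfold growth.
  set (g := sqrt (x * c)) in *.
  assert (Hg0 : 0 < g) by (apply sqrt_lt_R0; nra).
  assert (Hgg : g * g = x * c) by (apply sqrt_sqrt; nra).
  assert (E : x / c = (x / g) * (x / g)).
  { replace (x / g * (x / g)) with (x * x / (g * g)) by (field; lra).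
    rewrite Hgg; field; lra. }
  rewrite E.
  assert (H1 : 0 < x / g) by (apply Rdiv_lt_0_compat; auto).
  assert (H2 : 0 < c / g) by (apply Rdiv_lt_0_compat; auto).
  replace ((x + c - 2 * g) / g) with (x / g + c / g - 2) by (field; lra).
  set (u := x / g) in *; set (v := c / g) in *.
  assert (4 / 25 * u <= 1 + 4 / 25 * (u + v - 2)) by lra.
  nra.
Qed.

(** * Bernstein polynomials *)

Definition bern (L l : nat) (y : R) : R := Binomial.C L l * (y ^ l * (1 - y) ^ (L - l)).

Lemma binomial_pos L l : 0 < Binomial.C L l.
Proof.
  unfold Binomial.C. apply Rdiv_lt_0_compat; [apply INR_fact_lt_0|].
  apply Rmult_lt_0_compat; apply INR_fact_lt_0.
Qed.

Lemma bern_ge0 L l y : 0 <= y <= 1 -> 0 <= bern L l y.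
Proof.
  intros H; assert (Hb := binomial_pos L l).
  apply Rmult_le_pos; [lra|apply Rmult_le_pos; apply pow_le; lra].
Qed.

Lemma bern_sum L y : sum_n (fun l => bern L l y) L = 1.
Proof.
  rewrite sum_n_Reals.
  transitivity ((y + (1 - y)) ^ L); [|replace (y + (1 - y)) with 1 by ring; apply pow1].
  rewrite binomial; apply sum_eq; intros; unfold bern; ring.
Qed.

Lemma bern_le1 L l y : (l <= L)%nat -> 0 <= y <= 1 -> bern L l y <= 1.
Proof.
  intros Hl Hy; rewrite <- (bern_sum L y).
  apply (rsum_term_le (fun l => bern L l y)); auto using bern_ge0.
Qed.

(** The midpoint [g] of [y] and the peak [c] satisfies [bern g <= bern c], while
    [y * c] and [(1 - y) * (1 - c)] fall short of [g ^ 2] and [(1 - g) ^ 2] by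
    [((y - c) / 2) ^ 2]. *)
Lemma bern_decay L l : (l <= L)%nat -> exists c, 0 <= c <= 1 /\
  forall y, 0 <= y <= 1 -> bern L l y <= (1 - (y - c) * (y - c) / 4) ^ L.
Proof.
  intros Hl. destruct (continuity_ab_maj (bern L l) 0 1) as [c [Hc Hc1]]; [lra| |].
  { intros u _; unfold bern; apply derivable_continuous_pt; reg. }
  exists c; split; [auto|]. intros y Hy.
  assert (Bc : 0 < bern L l c).
  { apply Rlt_le_trans with (bern L l (1 / 2)); [|apply Hc; lra].
    apply Rmult_lt_0_compat; [apply binomial_pos|].
    apply Rmult_lt_0_compat; apply pow_lt; lra. }
  set (g := (y + c) / 2). set (t := (y - c) * (y - c) / 4).
  assert (Ht : 0 <= t <= 1).
  { assert (H : (y - c) * (y - c) <= 1 * 1) by (destruct (Rle_dec y c); nra).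
    unfold t; split; [|lra]. assert (H0 := Rle_0_sqr (y - c)); unfold Rsqr in H0; lra. }
  assert (Hg : 0 <= g <= 1) by (unfold g; lra).
  assert (H1 : 0 <= y * c <= g * g * (1 - t)).
  { replace (y * c) with (g * g - t) by (unfold g, t; field).
    assert (Hgg : 0 <= t * (1 - g * g)) by (apply Rmult_le_pos; nra). split; [|lra].
    replace (g * g - t) with (y * c) by (unfold g, t; field). nra. }
  assert (H2 : 0 <= (1 - y) * (1 - c) <= (1 - g) * (1 - g) * (1 - t)).
  { replace ((1 - y) * (1 - c)) with ((1 - g) * (1 - g) - t) by (unfold g, t; field).
    assert (Hgg : 0 <= t * (1 - (1 - g) * (1 - g))) by (apply Rmult_le_pos; nra).
    split; [|lra].
    replace ((1 - g) * (1 - g) - t) with ((1 - y) * (1 - c)) by (unfold g, t; field).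
    nra. }
  assert (D : bern L l y * bern L l c <= bern L l g * bern L l g * (1 - t) ^ L).
  { unfold bern; assert (Hb := binomial_pos L l).
    replace ((1 - t) ^ L) with ((1 - t) ^ l * (1 - t) ^ (L - l))
      by (rewrite <- pow_add; f_equal; lia).
    set (B := Binomial.C L l) in *.
    replace (B * (y ^ l * (1 - y) ^ (L - l)) * (B * (c ^ l * (1 - c) ^ (L - l))))
      with (B * B * ((y * c) ^ l * ((1 - y) * (1 - c)) ^ (L - l)))
      by (rewrite !Rpow_mult_distr; ring).
    replace (B * (g ^ l * (1 - g) ^ (L - l)) * (B * (g ^ l * (1 - g) ^ (L - l)))
       * ((1 - t) ^ l * (1 - t) ^ (L - l)))
      with (B * B * ((g * g * (1 - t)) ^ l * ((1 - g) * (1 - g) * (1 - t)) ^ (L - l)))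
      by (rewrite !Rpow_mult_distr; ring).
    apply Rmult_le_compat_l; [nra|].
    apply Rmult_le_compat; try (apply pow_le; lra); apply pow_incr; lra. }
  assert (Bg := Hc g Hg). assert (Bg0 := bern_ge0 L l g Hg).
  assert (B1 := bern_le1 L l c Hl Hc1).
  assert (Pt : 0 <= (1 - t) ^ L) by (apply pow_le; lra).
  apply Rmult_le_reg_r with (bern L l c); auto.
  apply Rle_trans with (1 := D).
  assert (bern L l g * bern L l g <= bern L l c) by nra. nra.
Qed.

(** * Compactness of rectangles *)

(** The local parameter [d] is the radius of the neighbourhood and at the same time
    the constant of the property [P], so that one lower bound makes everything
    uniform. *)
Lemma uniform_on_rectangle (a b a' b' : R) (P : R -> R -> R -> Prop) :
  (forall d d' x y, 0 < d' <= d -> P d x y -> P d' x y) ->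
  (forall u v, a <= u <= b -> a' <= v <= b' -> exists d, 0 < d /\
     forall x y, a <= x <= b -> a' <= y <= b' ->
       Rabs (x - u) < d -> Rabs (y - v) < d -> P d x y) ->
  exists d, 0 < d /\ forall x y, a <= x <= b -> a' <= y <= b' -> P d x y.
Proof.
  intros Hmono H.
  assert (H' : forall u v, exists d, 0 < d /\ (a <= u <= b -> a' <= v <= b' ->
     forall x y, a <= x <= b -> a' <= y <= b' ->
       Rabs (x - u) < d -> Rabs (y - v) < d -> P d x y)).
  { intros u v. destruct (classic (a <= u <= b /\ a' <= v <= b')) as [[Hu Hv]|N].
    - destruct (H u v Hu Hv) as [d [Hd Hd']]; exists d; auto.
    - exists 1; split; [lra|intros; tauto]. }
  set (delta := fun u v =>
    let s := constructive_indefinite_description _ (H' u v) in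
    mkposreal (proj1_sig s) (proj1 (proj2_sig s))).
  destruct (compactness_value_2d a b a' b' delta) as [d Hd].
  exists d; split; [apply cond_pos|]. intros x y Hx Hy.
  specialize (Hd x y Hx Hy). apply NNPP in Hd.
  destruct Hd as [u [v [Hu [Hv [Hxu [Hyv Hd]]]]]].
  apply Hmono with (delta u v); [split; [apply cond_pos|exact Hd]|].
  unfold delta in *; simpl in *.
  destruct (constructive_indefinite_description _ (H' u v)) as [d' [Hd'0 Hd']].
  simpl in *; auto.
Qed.

Lemma continuous_on_rectangle_bounded (a b a' b' : R) (v : R -> R -> R) :
  (forall x y, a <= x <= b -> a' <= y <= b' -> continuity_2d_pt v x y) ->
  exists M, 0 < M /\ forall x y, a <= x <= b -> a' <= y <= b' -> v x y <= M.
Proof.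
  intros Hc.
  destruct (uniform_on_rectangle a b a' b' (fun d x y => v x y <= / d)) as [d [Hd H]].
  - intros d d' x y Hd Hv; apply Rle_trans with (1 := Hv), Rinv_le_contravar; lra.
  - intros x0 y0 Hx0 Hy0. destruct (Hc x0 y0 Hx0 Hy0 (mkposreal 1 Rlt_0_1)) as [e He].
    simpl in He. assert (He0 := cond_pos e). assert (Hv := Rabs_pos (v x0 y0)).
    assert (Hi : 0 < / (Rabs (v x0 y0) + 1)) by (apply Rinv_0_lt_compat; lra).
    exists (Rmin e (/ (Rabs (v x0 y0) + 1))); split; [now apply Rmin_glb_lt|].
    intros x y _ _ Hx Hy.
    assert (B : Rabs (v x y - v x0 y0) < 1).
    { apply He; [apply Rlt_le_trans with (1 := Hx)|apply Rlt_le_trans with (1 := Hy)];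
        apply Rmin_l. }
    apply Rle_trans with (Rabs (v x0 y0) + 1).
    + apply Rabs_def2 in B; assert (H := Rle_abs (v x0 y0)); lra.
    + rewrite <- (Rinv_inv (Rabs (v x0 y0) + 1)) at 1.
      apply Rinv_le_contravar; [now apply Rmin_glb_lt|apply Rmin_r].
  - exists (/ d); split; [now apply Rinv_0_lt_compat|auto].
Qed.

Lemma continuous_on_rectangle_max (a b a' b' : R) (v : R -> R -> R) :
  a <= b -> a' <= b' ->
  (forall x y, a <= x <= b -> a' <= y <= b' -> continuity_2d_pt v x y) ->
  exists x0 y0, a <= x0 <= b /\ a' <= y0 <= b' /\
    forall x y, a <= x <= b -> a' <= y <= b' -> v x y <= v x0 y0.
Proof.
  intros Hab Hab' Hc.
  destruct (continuous_on_rectangle_bounded a b a' b' v Hc) as [M [HM0 HM]].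
  destruct (completeness (fun t => exists x y, a <= x <= b /\ a' <= y <= b' /\ t = v x y))
    as [S [HS1 HS2]].
  - exists M; intros t [x [y [Hx [Hy ->]]]]; auto.
  - exists (v a a'), a, a'; repeat split; lra.
  - assert (HS : forall x y, a <= x <= b -> a' <= y <= b' -> v x y <= S).
    { intros x y Hx Hy; apply HS1; exists x, y; auto. }
    apply NNPP; intros N.
    assert (Hlt : forall x y, a <= x <= b -> a' <= y <= b' -> v x y < S).
    { intros x y Hx Hy; destruct (HS x y Hx Hy) as [|E]; auto.
      destruct N; exists x, y; split; [auto|split; [auto|]].
      rewrite E; auto. }
    destruct (continuous_on_rectangle_bounded a b a' b' (fun x y => / (S - v x y)))
      as [K [HK0 HK]].
    { intros x y Hx Hy; apply continuity_2d_pt_inv.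
      - apply continuity_2d_pt_minus; [apply continuity_2d_pt_const|auto].
      - specialize (Hlt x y Hx Hy); lra. }
    assert (HiK : 0 < / K) by (apply Rinv_0_lt_compat; auto).
    assert (S <= S - / K); [|lra].
    apply HS2; intros t [x [y [Hx [Hy ->]]]].
    specialize (HK x y Hx Hy); specialize (Hlt x y Hx Hy).
    apply Rinv_le_contravar in HK; [|apply Rinv_0_lt_compat; lra].
    rewrite Rinv_inv in HK; lra.
Qed.

(** * Complex Taylor expansions *)

Definition expansion_at (g : C -> C) (z : C) (a : nat -> C) : Prop :=
  forall m : nat, exists K r : R, 0 < r /\ forall u : C, Cmod u < r ->
    Cmod (g (z + u) - sum_n (fun k => a k * Cpow u k) m)%C <= K * Cmod u ^ S m.

(** Complex differentiability in the strong form of Taylor expansions of every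
    order.  Unlike convergence of the Taylor series, it passes to the quotients
    [(g z - g p) / (z - p)] by finite computations. *)
Definition holo_at (g : C -> C) (z : C) : Prop := exists a, expansion_at g z a.

Lemma expansion_at_O g z a : expansion_at g z a -> a O = g z.
Proof.
  intros H; destruct (H O) as [K [r [Hr E]]].
  specialize (E (RtoC 0)). rewrite Cmod_0 in E. specialize (E Hr).
  rewrite csum_O, Cplus_0_r in E; simpl in E.
  rewrite Rmult_0_l, Rmult_0_r in E.
  assert (E0 : (g z - a O * 1)%C = 0%C).
  { apply Cmod_eq_0; apply Rle_antisym; [exact E|apply Cmod_ge_0]. }
  apply (f_equal (fun t => (t + a O)%C)) in E0.
  rewrite Cplus_0_l in E0; rewrite <- E0; ring.
Qed.

Lemma holo_at_ext g h z r : 0 < r ->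
  (forall u, Cmod u < r -> g (z + u)%C = h (z + u)%C) -> holo_at g z -> holo_at h z.
Proof.
  intros Hr E [a H]; exists a; intros m.
  destruct (H m) as [K [r' [Hr' B]]]; exists K, (Rmin r r').
  split; [now apply Rmin_glb_lt|]; intros u Hu.
  rewrite <- E by (eapply Rlt_le_trans; [exact Hu|apply Rmin_l]).
  apply B; eapply Rlt_le_trans; [exact Hu|apply Rmin_r].
Qed.

Lemma holo_at_plus g h z : holo_at g z -> holo_at h z ->
  holo_at (fun w => g w + h w)%C z.
Proof.
  intros [a Ha] [b Hb]; exists (fun k => a k + b k)%C; intros m.
  destruct (Ha m) as [K [r [Hr B]]]; destruct (Hb m) as [K' [r' [Hr' B']]].
  exists (K + K'), (Rmin r r'); split; [now apply Rmin_glb_lt|]; intros u Hu.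
  specialize (B u ltac:(eapply Rlt_le_trans; [exact Hu|apply Rmin_l])).
  specialize (B' u ltac:(eapply Rlt_le_trans; [exact Hu|apply Rmin_r])).
  rewrite (csum_ext _ (fun k => a k * Cpow u k + b k * Cpow u k)%C), csum_plus
    by (intros; cring).
  set (s := sum_n (fun k => a k * Cpow u k)%C m) in *.
  set (s' := sum_n (fun k => b k * Cpow u k)%C m) in *.
  change (Cmod (g (z + u) + h (z + u) - (s + s'))%C <= (K + K') * Cmod u ^ S m).
  replace (g (z + u) + h (z + u) - (s + s'))%C
    with ((g (z + u) - s) + (h (z + u) - s'))%C by ring.
  eapply Rle_trans; [apply Cmod_triangle|]. lra.
Qed.

Lemma holo_at_scal c g z : holo_at g z -> holo_at (fun w => c * g w)%C z.
Proof.
  intros [a Ha]; exists (fun k => c * a k)%C; intros m.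
  destruct (Ha m) as [K [r [Hr B]]].
  exists (Cmod c * K), r; split; auto; intros u Hu; specialize (B u Hu).
  rewrite (csum_ext _ (fun k => c * (a k * Cpow u k))%C), csum_mult_l
    by (intros; cring).
  set (s := sum_n (fun k => a k * Cpow u k)%C m) in *.
  change (Cmod (c * g (z + u) - c * s)%C <= Cmod c * K * Cmod u ^ S m).
  replace (c * g (z + u) - c * s)%C with (c * (g (z + u) - s))%C by ring.
  rewrite Cmod_mult, Rmult_assoc; apply Rmult_le_compat_l; [apply Cmod_ge_0|auto].
Qed.

Lemma holo_at_const c z : holo_at (fun _ => c) z.
Proof.
  exists (fun k => match k with O => c | _ => RtoC 0 end); intros m.
  exists 0, 1; split; [lra|]; intros u _.
  rewrite (csum_single _ _ 0) by (try lia; intros [|k]; try easy; intros; cring).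
  simpl; replace (c - c * 1)%C with (RtoC 0) by ring.
  rewrite Cmod_0; lra.
Qed.

Lemma holo_at_minus g h z : holo_at g z -> holo_at h z ->
  holo_at (fun w => g w - h w)%C z.
Proof.
  intros Hg Hh; apply holo_at_ext with (g := fun w => (g w + - (1) * h w)%C) (r := 1);
    [lra|intros; ring|].
  apply holo_at_plus; auto; now apply holo_at_scal.
Qed.

Lemma holo_at_affine g c s w : 0 < s -> holo_at g (c + RtoC s * w)%C ->
  holo_at (fun w => g (c + RtoC s * w)%C) w.
Proof.
  intros Hs [a Ha]; exists (fun k => a k * Cpow (RtoC s) k)%C; intros m.
  destruct (Ha m) as [K [r [Hr B]]].
  exists (K * s ^ S m), (r / s); split; [now apply Rdiv_lt_0_compat|]; intros u Hu.
  assert (E : Cmod (RtoC s * u)%C = s * Cmod u).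
  { rewrite Cmod_mult, Cmod_R, Rabs_pos_eq; lra. }
  specialize (B (RtoC s * u)%C). rewrite E in B.
  replace (c + RtoC s * (w + u))%C with (c + RtoC s * w + RtoC s * u)%C by ring.
  rewrite (csum_ext _ (fun k => a k * Cpow (RtoC s * u) k)%C).
  - rewrite Rpow_mult_distr in B. rewrite Rmult_assoc; apply B.
    apply Rmult_lt_reg_r with (/ s); [now apply Rinv_0_lt_compat|].
    replace (s * Cmod u * / s) with (Cmod u) by (field; lra). exact Hu.
  - intros; rewrite Cpow_mult_l; cring.
Qed.

Fixpoint quotient_coef (a : nat -> C) (w : C) (k : nat) : C :=
  match k with
  | O => a O / w
  | S k' => (a k - quotient_coef a w k') / w
  end%C.

(** The coefficients of the quotient solve [(w + u) * sum b k u ^ k = sum a k u ^ k]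
    with [w = z - p]; truncating both sums leaves the single term
    [b m u ^ (m + 1)]. *)
Lemma holo_at_div g z p : z <> p -> holo_at g z ->
  holo_at (fun w => g w / (w - p))%C z.
Proof.
  intros Hzp [a Ha]. set (w := (z - p)%C).
  assert (Hw : w <> 0%C) by (unfold w; now apply Cminus_eq_contra).
  assert (Hw0 := proj1 (Cmod_gt_0 w) Hw).
  set (b := quotient_coef a w). exists b; intros m.
  destruct (Ha m) as [K [r [Hr B]]].
  exists ((K + Cmod (b m)) * (2 / Cmod w)), (Rmin r (Cmod w / 2)).
  split; [apply Rmin_glb_lt; lra|]; intros u Hu.
  specialize (B u ltac:(eapply Rlt_le_trans; [exact Hu|apply Rmin_l])).
  assert (Hu2 : Cmod u < Cmod w / 2) by (eapply Rlt_le_trans; [exact Hu|apply Rmin_r]).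
  assert (Hwu : Cmod w / 2 <= Cmod (w + u)%C).
  { assert (T := Cmod_triangle (w + u) (- u)%C). rewrite Cmod_opp in T.
    replace (w + u + - u)%C with w in T by ring. lra. }
  assert (Hwu0 : (w + u)%C <> 0%C) by (apply Cmod_gt_0; lra).
  assert (I : forall n, ((w + u) * sum_n (fun k => b k * Cpow u k)%C n)%C
    = (sum_n (fun k => a k * Cpow u k)%C n + b n * Cpow u (S n))%C).
  { induction n as [|n IH].
    - rewrite !csum_O; unfold b; simpl.
      field. exact Hw.
    - rewrite csum_S, Cmult_plus_distr_l, IH, csum_S.
      unfold b at 2 3; simpl quotient_coef; fold b. simpl Cpow. field. exact Hw. }
  specialize (I m).
  set (s := sum_n (fun k => b k * Cpow u k)%C m) in *.
  set (t := sum_n (fun k => a k * Cpow u k)%C m) in *.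
  change (Cmod (g (z + u) / (z + u - p) - s)%C
    <= (K + Cmod (b m)) * (2 / Cmod w) * Cmod u ^ S m).
  change (Cmod (g (z + u) - t)%C <= K * Cmod u ^ S m) in B.
  change (@eq C ((w + u) * s)%C (t + b m * Cpow u (S m))%C) in I.
  replace (z + u - p)%C with (w + u)%C by (unfold w; ring).
  replace (g (z + u) / (w + u) - s)%C
    with ((g (z + u) - t + - (b m * Cpow u (S m))) / (w + u))%C.
  2: { replace t with ((w + u) * s - b m * Cpow u (S m))%C by (rewrite I; ring).
       field; auto. }
  rewrite Cmod_div by auto.
  assert (Hn : Cmod (g (z + u) - t + - (b m * Cpow u (S m)))%C
    <= (K + Cmod (b m)) * Cmod u ^ S m).
  { eapply Rle_trans; [apply Cmod_triangle|].
    rewrite Cmod_opp, Cmod_mult, Cmod_pow. lra. }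
  unfold Rdiv at 1.
  apply Rle_trans with ((K + Cmod (b m)) * Cmod u ^ S m * / Cmod (w + u)).
  - apply Rmult_le_compat_r; auto. apply Rlt_le, Rinv_0_lt_compat; lra.
  - assert (Hn0 := Rle_trans _ _ _ (Cmod_ge_0 _) Hn).
    replace ((K + Cmod (b m)) * (2 / Cmod w) * Cmod u ^ S m)
      with ((K + Cmod (b m)) * Cmod u ^ S m * / (Cmod w / 2)) by (field; lra).
    apply Rmult_le_compat_l; auto. apply Rinv_le_contravar; lra.
Qed.

(** The value at [p] must be the coefficient of order one; the expansion of the
    quotient is then that of [g] shifted by one place. *)
Lemma holo_at_difference_quotient g p a : expansion_at g p a ->
  holo_at (fun z => if excluded_middle_informative (z = p) then a 1%nat
                    else (g z - g p) / (z - p))%C p.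
Proof.
  intros Ha; exists (fun k => a (S k)); intros m.
  destruct (Ha (S m)) as [K [r [Hr B]]]; exists K, r; split; auto; intros u Hu.
  specialize (B u Hu).
  assert (I : forall n, sum_n (fun k => a k * Cpow u k)%C (S n)
     = (a O + u * sum_n (fun k => a (S k) * Cpow u k)%C n)%C).
  { induction n as [|n IH].
    - rewrite csum_S, !csum_O; simpl; cring.
    - rewrite csum_S, IH, (csum_S _ n); simpl; cring. }
  rewrite I in B.
  assert (E0 := expansion_at_O _ _ _ Ha). rewrite E0 in B.
  destruct (excluded_middle_informative ((p + u)%C = p)) as [E|E].
  - assert (E1 : u = RtoC 0).
    { replace u with ((p + u) - p)%C by ring. rewrite E; ring. }
    subst u. rewrite (csum_single _ _ 0).
    + simpl; replace (a 1%nat - a 1%nat * 1)%C with (RtoC 0) by ring.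
      rewrite Cmod_0; simpl; lra.
    + lia.
    + intros [|k] _ Hk; [easy|]; simpl; cring.
  - assert (Hu0 : u <> 0%C) by (intros E1; apply E; rewrite E1; ring).
    assert (Hu1 := proj1 (Cmod_gt_0 u) Hu0).
    set (s := sum_n (fun k => a (S k) * Cpow u k)%C m) in *.
    change (Cmod ((g (p + u) - g p) / (p + u - p) - s)%C <= K * Cmod u ^ S m).
    change (Cmod (g (p + u) - (g p + u * s))%C <= K * Cmod u ^ S (S m)) in B.
    replace ((g (p + u) - g p) / (p + u - p) - s)%C
      with ((g (p + u) - (g p + u * s)) / u)%C
      by (replace (p + u - p)%C with u by ring; field; auto).
    rewrite Cmod_div by auto.
    apply Rmult_le_reg_r with (Cmod u); auto.
    replace (Cmod (g (p + u) - (g p + u * s))%C / Cmod u * Cmod u)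
      with (Cmod (g (p + u) - (g p + u * s))%C) by (field; lra).
    simpl in *; lra.
Qed.

Lemma holo_at_lipschitz g z : holo_at g z -> exists K r, 0 < r /\ 0 <= K /\
  forall u, Cmod u < r -> Cmod (g (z + u) - g z)%C <= K * Cmod u.
Proof.
  intros [a Ha]; assert (E := expansion_at_O _ _ _ Ha).
  destruct (Ha O) as [K [r [Hr B]]]; exists (Rabs K), r.
  split; [auto|split; [apply Rabs_pos|]]; intros u Hu; specialize (B u Hu).
  rewrite csum_O, E in B; simpl in B; rewrite Cmult_1_r, Rmult_1_r in B.
  assert (Rabs K >= K) by (apply Rle_ge, Rle_abs). assert (H0 := Cmod_ge_0 u). nra.
Qed.

Lemma is_series_Cmod_close (t : nat -> C) (l : C) eps : 0 < eps ->
  @is_series C_AbsRing C_NormedModule t l ->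
  exists N, forall n, (N <= n)%nat -> Cmod (sum_n t n - l)%C < eps.
Proof.
  intros He H.
  assert (L : locally_norm (V := C_NormedModule) l
    (fun y => norm (minus y l) < eps)).
  { exists (mkposreal eps He); intros y Hy; exact Hy. }
  apply (locally_le_locally_norm (V := C_NormedModule)) in L.
  destruct (H _ L) as [N HN]; exists N; intros n Hn; apply (HN n Hn).
Qed.

Lemma is_series_bounded (t : nat -> C) (l : C) :
  @is_series C_AbsRing C_NormedModule t l ->
  exists A, 0 <= A /\ forall k, Cmod (t k) <= A.
Proof.
  intros H. destruct (is_series_Cmod_close t l 1 Rlt_0_1 H) as [N HN].
  assert (HB : exists A, 0 <= A /\ forall k, (k < S N)%nat -> Cmod (t k) <= A).
  { generalize (S N); clear; intros n; induction n as [|n [A [HA0 HA]]].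
    - exists 0; split; [lra|lia].
    - exists (A + Cmod (t n)); assert (H := Cmod_ge_0 (t n)); split; [lra|].
      intros k Hk; destruct (Nat.eq_dec k n) as [->|]; [lra|].
      specialize (HA k ltac:(lia)); lra. }
  destruct HB as [A [HA0 HA]]; exists (A + 2); split; [lra|]; intros k.
  destruct (Nat.le_gt_cases (S N) k) as [Hk|Hk]; [|specialize (HA k Hk); lra].
  destruct k as [|k]; [lia|].
  assert (H1 := HN (S k) ltac:(lia)); assert (H2 := HN k ltac:(lia)).
  rewrite csum_S in H1.
  set (s := sum_n t k) in *.
  replace (t (S k)) with ((s + t (S k) - l) + - (s - l))%C by ring.
  eapply Rle_trans; [apply Cmod_triangle|]. rewrite Cmod_opp.
  change (Cmod (s + t (S k) - l)%C < 1) in H1. lra.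
Qed.

Lemma is_series_geometric_tail (t : nat -> C) (l : C) A q m :
  @is_series C_AbsRing C_NormedModule t l ->
  0 <= A -> 0 <= q <= 1 / 2 -> (forall k, Cmod (t k) <= A * q ^ k) ->
  Cmod (l - sum_n t m)%C <= 2 * A * q ^ S m.
Proof.
  intros H HA Hq Ht.
  assert (T : forall p, Cmod (sum_n t (m + p) - sum_n t m)%C
    <= 2 * A * q ^ S m - 2 * A * q ^ S (m + p)).
  { induction p as [|p IH].
    - rewrite Nat.add_0_r. replace (sum_n t m - sum_n t m)%C with (RtoC 0) by cring.
      rewrite Cmod_0; lra.
    - rewrite Nat.add_succ_r, csum_S.
      set (s := sum_n t (m + p)) in *. set (s0 := sum_n t m) in *.
      change (Cmod (s + t (S (m + p)) - s0)%C
        <= 2 * A * q ^ S m - 2 * A * q ^ S (S (m + p))).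
      replace (s + t (S (m + p)) - s0)%C with ((s - s0) + t (S (m + p)))%C by ring.
      eapply Rle_trans; [apply Cmod_triangle|].
      specialize (Ht (S (m + p))).
      change (q ^ S (S (m + p))) with (q * q ^ S (m + p)).
      assert (Hp : 0 <= A * q ^ S (m + p)) by (apply Rmult_le_pos; [lra|apply pow_le; lra]).
      change (Cmod (s - s0)%C <= 2 * A * q ^ S m - 2 * A * q ^ S (m + p)) in IH.
      nra. }
  apply le_epsilon; intros eps He.
  destruct (is_series_Cmod_close t l eps He H) as [N HN].
  specialize (HN (m + N)%nat ltac:(lia)); specialize (T N).
  set (s := sum_n t (m + N)) in *. set (s0 := sum_n t m) in *.
  change (Cmod (l - s0)%C <= 2 * A * q ^ S m + eps).
  replace (l - s0)%C with (- (s - l) + (s - s0))%C by ring.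
  eapply Rle_trans; [apply Cmod_triangle|]. rewrite Cmod_opp.
  change (Cmod (s - l)%C < eps) in HN.
  change (Cmod (s - s0)%C <= 2 * A * q ^ S m - 2 * A * q ^ S (m + N)) in T.
  assert (Hp : 0 <= A * q ^ S (m + N)) by (apply Rmult_le_pos; [lra|apply pow_le; lra]).
  lra.
Qed.

Lemma pow_n_Cpow (u : C) k : @pow_n C_AbsRing u k = Cpow u k.
Proof. induction k as [|k IH]; simpl; [reflexivity|rewrite IH; reflexivity]. Qed.

Lemma analytic1_holo g z : analytic1_at g z -> holo_at g z.
Proof.
  intros [a [r [Hr H]]].
  assert (H' : forall u, Cmod u < r -> @is_series C_AbsRing C_NormedModule
    (fun k => Cpow u k * a k)%C (g (z + u)%C)).
  { intros u Hu. specialize (H (z + u)%C).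
    replace (z + u - z)%C with u in H by ring. specialize (H Hu).
    eapply is_series_ext; [|exact H]. intros k; simpl.
    rewrite pow_n_Cpow; reflexivity. }
  destruct (is_series_bounded _ _ (H' (RtoC (r / 2))
    ltac:(rewrite Cmod_R, Rabs_pos_eq; lra))) as [A [HA0 HA]].
  exists a; intros m. exists (2 * A * (2 / r) ^ S m), (r / 4); split; [lra|].
  intros u Hu.
  assert (Hu0 := Cmod_ge_0 u).
  assert (T := is_series_geometric_tail _ _ A (2 / r * Cmod u) m
    (H' u ltac:(lra)) HA0).
  rewrite Rpow_mult_distr, <- Rmult_assoc in T.
  rewrite (csum_ext _ (fun k => Cpow u k * a k)%C) by (intros; cring).
  apply T.
  - split.
    + apply Rmult_le_pos; auto. apply Rlt_le, Rdiv_lt_0_compat; lra.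
    + apply Rmult_le_reg_l with r; auto.
      replace (r * (2 / r * Cmod u)) with (2 * Cmod u) by (field; lra). lra.
  - intros k; specialize (HA k).
    rewrite Cmod_mult, Cmod_pow, Cmod_R, Rabs_pos_eq in HA by lra.
    rewrite Cmod_mult, Cmod_pow.
    replace (A * (2 / r * Cmod u) ^ k) with (A * (Cmod u ^ k * (2 / r) ^ k))
      by (rewrite Rpow_mult_distr; ring).
    assert (P : 0 < (r / 2) ^ k) by (apply pow_lt; lra).
    assert (E : (2 / r) ^ k * (r / 2) ^ k = 1).
    { rewrite <- Rpow_mult_distr. replace (2 / r * (r / 2)) with 1 by (field; lra).
      apply pow1. }
    assert (P' : 0 <= (2 / r) ^ k) by (apply pow_le, Rlt_le, Rdiv_lt_0_compat; lra).
    assert (P'' : 0 <= Cmod u ^ k) by now apply pow_le.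
    replace (Cmod u ^ k * Cmod (a k))
      with (Cmod u ^ k * (2 / r) ^ k * ((r / 2) ^ k * Cmod (a k))).
    + rewrite (Rmult_comm A). apply Rmult_le_compat_l; auto.
      now apply Rmult_le_pos.
    + rewrite <- (Rmult_1_l (Cmod (a k))) at 2. rewrite <- E; ring.
Qed.

Lemma homog_part_0_r a u n : homog_part a u 0 n = (a n O * Cpow u n)%C.
Proof.
  unfold homog_part; rewrite (csum_single _ _ 0); [|lia|].
  - rewrite Nat.sub_0_r; simpl; cring.
  - intros [|k] _ Hk; [easy|]; simpl; cring.
Qed.

Lemma homog_part_0_l a v n : homog_part a 0 v n = (a O n * Cpow v n)%C.
Proof.
  unfold homog_part; rewrite (csum_single _ _ n); [|lia|].
  - rewrite Nat.sub_diag; simpl; cring.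
  - intros k Hk ne. destruct (n - k)%nat eqn:E; [lia|]; simpl; cring.
Qed.

Lemma analytic2_fst F c1 c2 : analytic2_at F c1 c2 -> analytic1_at (fun z => F z c2) c1.
Proof.
  intros [a [r [Hr H]]]; exists (fun n => a n O), r; split; auto; intros z Hz.
  destruct (H z c2 Hz) as [_ S].
  - replace (c2 - c2)%C with (RtoC 0) by ring; rewrite Cmod_0; auto.
  - replace (c2 - c2)%C with (RtoC 0) in S by ring.
    eapply is_series_ext; [|exact S]; intros k.
    rewrite homog_part_0_r, <- pow_n_Cpow; apply Cmult_comm.
Qed.

Lemma analytic2_snd F c1 c2 : analytic2_at F c1 c2 -> analytic1_at (fun z => F c1 z) c2.
Proof.
  intros [a [r [Hr H]]]; exists (fun n => a O n), r; split; auto; intros z Hz.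
  destruct (H c1 z) as [_ S]; auto.
  - replace (c1 - c1)%C with (RtoC 0) by ring; rewrite Cmod_0; auto.
  - replace (c1 - c1)%C with (RtoC 0) in S by ring.
    eapply is_series_ext; [|exact S]; intros k.
    rewrite homog_part_0_l, <- pow_n_Cpow; apply Cmult_comm.
Qed.

(** * The maximum principle on a square *)

Definition in_square (z : C) : Prop := Rabs (Re z) <= 1 /\ Rabs (Im z) <= 1.

Definition on_boundary (z : C) : Prop :=
  in_square z /\ (Rabs (Re z) = 1 \/ Rabs (Im z) = 1).

Lemma Cmod_le_abs_sum (z : C) : Cmod z <= Rabs (Re z) + Rabs (Im z).
Proof.
  apply Rsqr_incr_0_var.
  - rewrite !Rsqr_pow2, Cmod2_alt. rewrite <- (pow2_abs (Re z)), <- (pow2_abs (Im z)).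
    assert (H := Rabs_pos (Re z)); assert (H' := Rabs_pos (Im z)). nra.
  - assert (H := Rabs_pos (Re z)); assert (H' := Rabs_pos (Im z)). lra.
Qed.

Lemma im_le_Cmod (z : C) : Rabs (Im z) <= Cmod z.
Proof. eapply Rle_trans; [|apply Rmax_Cmod]; apply Rmax_r. Qed.

Lemma Cmod_minus_sym (a b : C) : Cmod (a - b)%C = Cmod (b - a)%C.
Proof. rewrite <- Cmod_opp; f_equal; ring. Qed.

Lemma continuity_2d_holo g x y : holo_at g (x, y) ->
  continuity_2d_pt (fun x y => Cmod (g (x, y))) x y.
Proof.
  intros H; destruct (holo_at_lipschitz _ _ H) as [K [r [Hr [HK B]]]]; intros eps.
  assert (He := cond_pos eps).
  assert (Hd : 0 < Rmin (r / 2) (eps / (2 * (K + 1)))).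
  { apply Rmin_glb_lt; [lra|apply Rdiv_lt_0_compat; lra]. }
  exists (mkposreal _ Hd); simpl; intros x' y' Hx Hy.
  set (u := (x' - x, y' - y) : C).
  assert (Hu : Cmod u < 2 * Rmin (r / 2) (eps / (2 * (K + 1)))).
  { eapply Rle_lt_trans; [apply Cmod_le_abs_sum|]. simpl; lra. }
  assert (Hu1 : Cmod u < r).
  { assert (Q := Rmin_l (r / 2) (eps / (2 * (K + 1)))); lra. }
  assert (Hu2 : Cmod u * (K + 1) < eps).
  { assert (Q := Rmin_r (r / 2) (eps / (2 * (K + 1)))).
    apply Rlt_le_trans with (2 * (eps / (2 * (K + 1))) * (K + 1)).
    - apply Rmult_lt_compat_r; lra.
    - apply Req_le; field; lra. }
  specialize (B u Hu1).
  replace ((x, y) + u)%C with ((x', y') : C) in B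
    by (unfold u; apply injective_projections; simpl; ring).
  assert (T1 := Cmod_triangle (g (x', y') - g (x, y))%C (g (x, y))).
  assert (T2 := Cmod_triangle (g (x, y) - g (x', y'))%C (g (x', y'))).
  rewrite (Cmod_minus_sym (g (x, y))) in T2.
  replace (g (x', y') - g (x, y) + g (x, y))%C with (g (x', y')) in T1 by ring.
  replace (g (x, y) - g (x', y') + g (x', y'))%C with (g (x, y)) in T2 by ring.
  assert (Hu0 := Cmod_ge_0 u).
  apply Rabs_def1; nra.
Qed.

(** The mean over the four points [z + h], [z - h], [z + i h], [z - i h] reproduces
    [g z] up to third order, so that the mean of [Cmod g ^ 2] is at least
    [Cmod (g z) ^ 2] up to third order. *)
Lemma four_point_mean g x y : holo_at g (x, y) -> exists K r, 0 < r /\ 0 <= K /\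
  forall h, 0 < h < r ->
    4 * Cmod (g (x, y)) ^ 2 - K * h ^ 3 <=
    Cmod (g (x + h, y)) ^ 2 + Cmod (g (x - h, y)) ^ 2
    + Cmod (g (x, y + h)) ^ 2 + Cmod (g (x, y - h)) ^ 2.
Proof.
  intros [a Ha]. assert (E0 := expansion_at_O _ _ _ Ha).
  destruct (Ha 2%nat) as [K [r [Hr B]]].
  set (p := Re (a O)); set (q := Im (a O)).
  exists (8 * (Rabs p + Rabs q) * Rabs K), r; split; auto.
  assert (Hp := Rabs_pos p); assert (Hq := Rabs_pos q); assert (HK := Rabs_pos K).
  split; [apply Rmult_le_pos; lra|].
  intros h Hh.
  assert (B' : forall u, Cmod u = h -> exists e,
    g ((x, y) + u)%C = (a O + a 1%nat * u + a 2%nat * (u * u) + e)%C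
    /\ Cmod e <= Rabs K * h ^ 3).
  { intros u Hu; specialize (B u ltac:(lra)); rewrite !csum_S, csum_O in B.
    eexists; split; [|eapply Rle_trans; [exact B|]].
    - simpl. set (w := g ((x, y) + u)%C).
      change (@eq C w (a O + a 1%nat * u + a 2%nat * (u * u)
        + (w - (a O * 1 + a 1%nat * (u * 1) + a 2%nat * (u * (u * 1)))))%C). ring.
    - rewrite Hu. apply Rmult_le_compat_r; [apply pow_le; lra|apply Rle_abs]. }
  destruct (B' (RtoC h)) as [e1 [E1 L1]]; [rewrite Cmod_R, Rabs_pos_eq; lra|].
  destruct (B' (RtoC (- h))) as [e2 [E2 L2]];
    [rewrite Cmod_R, Rabs_Ropp, Rabs_pos_eq; lra|].
  destruct (B' (RtoC h * Ci)%C) as [e3 [E3 L3]];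
    [rewrite Cmod_mult, Cmod_Ci, Cmod_R, Rabs_pos_eq; lra|].
  destruct (B' (RtoC (- h) * Ci)%C) as [e4 [E4 L4]];
    [rewrite Cmod_mult, Cmod_Ci, Cmod_R, Rabs_Ropp, Rabs_pos_eq; lra|].
  replace ((x, y) + RtoC h)%C with ((x + h, y) : C) in E1
    by (apply injective_projections; simpl; ring).
  replace ((x, y) + RtoC (- h))%C with ((x - h, y) : C) in E2
    by (apply injective_projections; simpl; ring).
  replace ((x, y) + RtoC h * Ci)%C with ((x, y + h) : C) in E3
    by (apply injective_projections; simpl; ring).
  replace ((x, y) + RtoC (- h) * Ci)%C with ((x, y - h) : C) in E4
    by (apply injective_projections; simpl; ring).
  assert (S : (g (x + h, y)%R + g (x - h, y)%R + g (x, y + h)%R + g (x, y - h)%R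
    = 4 * a O + (e1 + e2 + e3 + e4))%C).
  { rewrite E1, E2, E3, E4. rewrite !RtoC_opp.
    replace (RtoC h * Ci * (RtoC h * Ci))%C with (- (RtoC h * RtoC h))%C
      by (apply injective_projections; simpl; ring).
    replace (- RtoC h * Ci * (- RtoC h * Ci))%C with (- (RtoC h * RtoC h))%C
      by (apply injective_projections; simpl; ring).
    ring. }
  clear E1 E2 E3 E4.
  set (e := (e1 + e2 + e3 + e4)%C) in *.
  assert (Le : Cmod e <= 4 * (Rabs K * h ^ 3)).
  { unfold e.
    assert (T1 := Cmod_triangle (e1 + e2 + e3)%C e4).
    assert (T2 := Cmod_triangle (e1 + e2)%C e3).
    assert (T3 := Cmod_triangle e1 e2). lra. }
  assert (SR := f_equal Re S); assert (SI := f_equal Im S).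
  rewrite <- E0, !Cmod2_alt. fold p q.
  assert (LR := Rle_trans _ _ _ (re_le_Cmod e) Le).
  assert (LI := Rle_trans _ _ _ (im_le_Cmod e) Le).
  set (g1 := g (x + h, y)) in *; set (g2 := g (x - h, y)) in *.
  set (g3 := g (x, y + h)) in *; set (g4 := g (x, y - h)) in *.
  assert (SR' : Re g1 + Re g2 + Re g3 + Re g4 = 4 * p + Re e).
  { unfold p; clear - SR; simpl in SR; unfold Re in *; simpl in *; lra. }
  assert (SI' : Im g1 + Im g2 + Im g3 + Im g4 = 4 * q + Im e).
  { unfold q; clear - SI; simpl in SI; unfold Im in *; simpl in *; lra. }
  assert (Q : forall s t, s ^ 2 >= 2 * t * s - t ^ 2).
  { intros s t; assert (H := pow2_ge_0 (s - t)); nra. }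
  assert (Q1 := Q (Re g1) p); assert (Q2 := Q (Re g2) p).
  assert (Q3 := Q (Re g3) p); assert (Q4 := Q (Re g4) p).
  assert (R1 := Q (Im g1) q); assert (R2 := Q (Im g2) q).
  assert (R3 := Q (Im g3) q); assert (R4 := Q (Im g4) q).
  assert (Hpe : - (Rabs p * (4 * (Rabs K * h ^ 3))) <= p * Re e).
  { assert (H : Rabs (p * Re e) <= Rabs p * (4 * (Rabs K * h ^ 3))).
    { rewrite Rabs_mult; apply Rmult_le_compat_l; auto. }
    apply Rabs_le_between in H; lra. }
  assert (Hqe : - (Rabs q * (4 * (Rabs K * h ^ 3))) <= q * Im e).
  { assert (H : Rabs (q * Im e) <= Rabs q * (4 * (Rabs K * h ^ 3))).
    { rewrite Rabs_mult; apply Rmult_le_compat_l; auto. }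
    apply Rabs_le_between in H; lra. }
  replace (8 * (Rabs p + Rabs q) * Rabs K * h ^ 3)
    with (2 * (Rabs p * (4 * (Rabs K * h ^ 3))) + 2 * (Rabs q * (4 * (Rabs K * h ^ 3))))
    by ring.
  assert (PR : 2 * p * (Re g1 + Re g2 + Re g3 + Re g4) = 8 * p ^ 2 + 2 * (p * Re e))
    by (rewrite SR'; ring).
  assert (PI : 2 * q * (Im g1 + Im g2 + Im g3 + Im g4) = 8 * q ^ 2 + 2 * (q * Im e))
    by (rewrite SI'; ring).
  lra.
Qed.

(** If [Cmod g] exceeded its bound on the boundary somewhere inside, then so would
    [Cmod g ^ 2 + eps * Cmod z ^ 2] for a small [eps]; but this function has no
    interior maximum, since its four-point means exceed its value by [4 eps h ^ 2]
    up to third order. *)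
Lemma maximum_principle g M : (forall z, in_square z -> holo_at g z) ->
  (forall z, on_boundary z -> Cmod (g z) <= M) ->
  forall z, in_square z -> Cmod (g z) <= M.
Proof.
  intros Hg HM zs Hzs. apply Rnot_lt_le; intros Hlt.
  assert (HM0 : 0 <= M).
  { apply Rle_trans with (Cmod (g (1, 0))); [apply Cmod_ge_0|apply HM].
    unfold on_boundary, in_square; simpl; rewrite Rabs_R0, Rabs_R1; lra. }
  (* A third of the excess: at a boundary point of the square, [Cmod z ^ 2] is at
     most 2. *)
  set (eps := (Cmod (g zs) ^ 2 - M ^ 2) / 3).
  assert (He : 0 < eps) by (unfold eps; nra).
  set (v := fun x y => Cmod (g (x, y)) * Cmod (g (x, y)) + eps * (x * x + y * y)).
  destruct (continuous_on_rectangle_max (-1) 1 (-1) 1 v) as [x0 [y0 [Hx0 [Hy0 Hmax]]]];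
    try lra.
  { intros x y Hx Hy.
    assert (Hc : continuity_2d_pt (fun x y => Cmod (g (x, y))) x y).
    { apply continuity_2d_holo, Hg; split; apply Rabs_le_between; simpl; lra. }
    apply continuity_2d_pt_plus; [now apply continuity_2d_pt_mult|].
    apply continuity_2d_pt_mult; [apply continuity_2d_pt_const|].
    apply continuity_2d_pt_plus; apply continuity_2d_pt_mult;
      first [apply continuity_2d_pt_id1|apply continuity_2d_pt_id2]. }
  assert (Hin : in_square (x0, y0)) by (split; apply Rabs_le_between; simpl; lra).
  assert (Hv : M * M + 2 * eps < v x0 y0).
  { destruct zs as [xs ys]. destruct Hzs as [Hxs Hys].
    apply Rabs_le_between in Hxs; apply Rabs_le_between in Hys; simpl in Hxs, Hys.
    apply Rlt_le_trans with (v xs ys); [|apply Hmax; lra].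
    assert (0 <= xs * xs + ys * ys) by nra.
    assert (M * M + 3 * eps = Cmod (g (xs, ys)) * Cmod (g (xs, ys)))
      by (unfold eps; field).
    unfold v; nra. }
  assert (Hint : Rabs x0 < 1 /\ Rabs y0 < 1).
  { assert (Hb : on_boundary (x0, y0) -> False).
    { intros Hb; specialize (HM _ Hb). assert (H0 := Cmod_ge_0 (g (x0, y0))).
      assert (Cmod (g (x0, y0)) * Cmod (g (x0, y0)) <= M * M) by nra.
      assert (x0 * x0 + y0 * y0 <= 2) by nra. unfold v in Hv; nra. }
    destruct Hin as [H1 H2]; simpl in H1, H2.
    split; [destruct H1 as [|H1]; auto|destruct H2 as [|H2]; auto];
      exfalso; apply Hb; split; simpl; auto; split; simpl; auto; lra. }
  destruct (four_point_mean g x0 y0 (Hg _ Hin)) as [K [r [Hr [HK B]]]].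
  set (h := Rmin (Rmin (r / 2) (eps / (K + 1))) (Rmin (1 - Rabs x0) (1 - Rabs y0))).
  assert (Hh : 0 < h).
  { repeat apply Rmin_glb_lt; try lra. apply Rdiv_lt_0_compat; lra. }
  assert (Hh1 : h <= r / 2) by (unfold h; eapply Rle_trans; [apply Rmin_l|apply Rmin_l]).
  assert (Hh2 : h <= eps / (K + 1))
    by (unfold h; eapply Rle_trans; [apply Rmin_l|apply Rmin_r]).
  assert (Hh3 : h <= 1 - Rabs x0)
    by (unfold h; eapply Rle_trans; [apply Rmin_r|apply Rmin_l]).
  assert (Hh4 : h <= 1 - Rabs y0)
    by (unfold h; eapply Rle_trans; [apply Rmin_r|apply Rmin_r]).
  specialize (B h ltac:(lra)).
  assert (Ax := Rabs_le_between x0 (Rabs x0)); assert (Ay := Rabs_le_between y0 (Rabs y0)).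
  destruct (proj1 Ax (Rle_refl _)) as [Ax1 Ax2]; destruct (proj1 Ay (Rle_refl _)) as [Ay1 Ay2].
  assert (M1 := Hmax (x0 + h) y0 ltac:(lra) ltac:(lra)).
  assert (M2 := Hmax (x0 - h) y0 ltac:(lra) ltac:(lra)).
  assert (M3 := Hmax x0 (y0 + h) ltac:(lra) ltac:(lra)).
  assert (M4 := Hmax x0 (y0 - h) ltac:(lra) ltac:(lra)).
  unfold v in M1, M2, M3, M4.
  assert (D : 4 * eps * h ^ 2 <= K * h ^ 3) by nra.
  assert (Hk : h * (K + 1) <= eps).
  { apply Rmult_le_reg_r with (/ (K + 1)); [apply Rinv_0_lt_compat; lra|].
    replace (h * (K + 1) * / (K + 1)) with h by (field; lra). exact Hh2. }
  assert (Hh5 : 0 < h ^ 2) by (apply pow_lt; lra).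
  nra.
Qed.

(** * Newton interpolation of bounded analytic functions *)

(** On the boundary of the square [z] is at distance at least [15 / 16] from [p], so
    the quotient is at most [2 M * 16 / 15] there. *)
Lemma difference_quotient_bound g M p : (forall z, in_square z -> holo_at g z) ->
  (forall z, in_square z -> Cmod (g z) <= M) -> 0 <= p <= 1 / 16 ->
  exists g1 : C -> C, (forall z, in_square z -> holo_at g1 z) /\
    (forall z, in_square z -> Cmod (g1 z) <= 3 * M) /\
    forall z, z <> RtoC p -> g1 z = ((g z - g (RtoC p)) / (z - RtoC p))%C.
Proof.
  intros Hg HM Hp.
  assert (Ip : in_square (RtoC p)).
  { split; simpl; apply Rabs_le_between; lra. }
  destruct (Hg _ Ip) as [a Ha].
  exists (fun z => if excluded_middle_informative (z = RtoC p) then a 1%nat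
                   else (g z - g (RtoC p)) / (z - RtoC p))%C.
  assert (Hne : forall z, z <> RtoC p ->
    (if excluded_middle_informative (z = RtoC p) then a 1%nat
                   else (g z - g (RtoC p)) / (z - RtoC p))%C
    = ((g z - g (RtoC p)) / (z - RtoC p))%C).
  { intros z Hz; destruct (excluded_middle_informative (z = RtoC p)); easy. }
  assert (Hh : forall z, in_square z -> holo_at
    (fun z => if excluded_middle_informative (z = RtoC p) then a 1%nat
                   else (g z - g (RtoC p)) / (z - RtoC p))%C z).
  { intros z Hz. destruct (excluded_middle_informative (z = RtoC p)) as [->|Hzp].
    - now apply holo_at_difference_quotient.
    - assert (Hd : 0 < Cmod (z - RtoC p)%C)
        by (apply Cmod_gt_0; now apply Cminus_eq_contra).
      apply holo_at_ext with (g := fun z => ((g z - g (RtoC p)) / (z - RtoC p))%C)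
        (r := Cmod (z - RtoC p)%C); auto.
      + intros u Hu; symmetry; apply Hne; intros E.
        replace (z - RtoC p)%C with (- u)%C in Hu by (rewrite <- E; ring).
        rewrite Cmod_opp in Hu; lra.
      + apply (holo_at_div (fun z => g z - g (RtoC p))%C); auto.
        apply holo_at_minus; auto; apply holo_at_const. }
  split; [exact Hh|split; [|exact Hne]].
  apply maximum_principle; [exact Hh|].
  intros z [Hz Hb].
  assert (Hd : 15 / 16 <= Cmod (z - RtoC p)%C).
  { destruct Hb as [Hb|Hb].
    - eapply Rle_trans; [|apply re_le_Cmod]. simpl.
      unfold Rabs in *; destruct (Rcase_abs (Re z));
        destruct (Rcase_abs (fst z + - p)); unfold Re in *; lra.
    - eapply Rle_trans; [|apply im_le_Cmod]. simpl. rewrite Ropp_0, Rplus_0_r.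
      unfold Im in Hb; lra. }
  assert (Hz0 : (z - RtoC p)%C <> 0%C) by (apply Cmod_gt_0; lra).
  assert (Hzp : z <> RtoC p) by (intros E; apply Hz0; rewrite E; ring).
  rewrite Hne by auto. rewrite Cmod_div by auto.
  assert (M1 := HM _ Hz); assert (M2 := HM _ Ip).
  assert (T := Cmod_triangle (g z) (- g (RtoC p))%C). rewrite Cmod_opp in T.
  apply Rmult_le_reg_r with (Cmod (z - RtoC p)%C); [lra|].
  replace (Cmod (g z - g (RtoC p))%C / Cmod (z - RtoC p)%C * Cmod (z - RtoC p)%C)
    with (Cmod (g z - g (RtoC p))%C) by (field; lra).
  assert (M0 := Cmod_ge_0 (g z)).
  apply Rle_trans with (2 * M); [unfold Cminus; lra|nra].
Qed.

(** The nodes are distinct, so that the Newton coefficients are linear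
    combinations of values of the function, and lie so close to the centre that the
    factor 3 of [difference_quotient_bound] is outweighed by
    [Cmod (z - node j) <= 1 / 8]. *)
Definition node (j : nat) : R := / (16 * (INR j + 1)).

Lemma node_range j : 0 <= node j <= 1 / 16.
Proof.
  assert (H := pos_INR j); unfold node; split.
  - apply Rlt_le, Rinv_0_lt_compat; lra.
  - replace (1 / 16) with (/ 16) by lra. apply Rinv_le_contravar; lra.
Qed.

Lemma node_inj i j : i <> j -> RtoC (node i) <> RtoC (node j).
Proof.
  intros H E; apply RtoC_inj in E; apply H; unfold node in E.
  apply Rinv_eq_reg in E. apply INR_eq; lra.
Qed.

Lemma node_in_square j : in_square (RtoC (node j)).
Proof.
  assert (H := node_range j).
  split; simpl; apply Rabs_le_between; lra.
Qed.

Fixpoint node_prod (k : nat) (z : C) : C :=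
  match k with O => RtoC 1 | S k => node_prod k z * (z - RtoC (node k)) end%C.

(** The divided difference of [g] at the first [k] nodes and [z].  It is meaningless
    when [z] is one of these nodes, but the recursion only evaluates it at later
    ones. *)
Fixpoint div_diff (g : C -> C) (k : nat) (z : C) : C :=
  match k with
  | O => g z
  | S k => (div_diff g k z - div_diff g k (RtoC (node k))) / (z - RtoC (node k))
  end%C.

Definition newton_coef (g : C -> C) (k : nat) : C := div_diff g k (RtoC (node k)).

Definition newton_poly (g : C -> C) (q : nat) (z : C) : C :=
  sum_n (fun k => newton_coef g k * node_prod k z)%C q.

Lemma node_prod_poly1 k : poly1_deg_le k (node_prod k).
Proof.
  induction k as [|k IH]; [apply poly1_const|].
  replace (S k) with (k + 1)%nat by lia. simpl.
  apply poly1_ext with (P := fun z => (node_prod k z * (z + - RtoC (node k)))%C).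
  { intros; rewrite Nat.add_1_r; reflexivity. }
  apply poly1_mult; [exact IH|apply poly1_linear].
Qed.

Lemma newton_poly_poly1 g q : poly1_deg_le q (newton_poly g q).
Proof.
  apply poly1_sum; intros k Hk; apply poly1_scal.
  apply poly1_le with k; [exact Hk|apply node_prod_poly1].
Qed.

Lemma node_prod_near k z : Cmod z <= 1 / 16 -> Cmod (node_prod k z) <= (1 / 8) ^ k.
Proof.
  intros Hz; induction k as [|k IH]; simpl; [rewrite Cmod_1; lra|].
  rewrite Cmod_mult, Rmult_comm.
  apply Rmult_le_compat; try apply Cmod_ge_0; auto.
  eapply Rle_trans; [apply Cmod_triangle|].
  assert (H := node_range k); rewrite Cmod_opp, Cmod_R, Rabs_pos_eq; lra.
Qed.

Lemma node_prod_growth k z : Cmod (node_prod k z) <= (1 + Cmod z) ^ k.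
Proof.
  induction k as [|k IH]; simpl; [rewrite Cmod_1; lra|].
  rewrite Cmod_mult, Rmult_comm.
  apply Rmult_le_compat; try apply Cmod_ge_0; auto.
  eapply Rle_trans; [apply Cmod_triangle|].
  assert (H := node_range k); rewrite Cmod_opp, Cmod_R, Rabs_pos_eq; lra.
Qed.

(** Each of the successive difference quotients is analytic, and at most three times
    as large as the preceding one by the maximum principle. *)
Lemma newton_expansion g M : (forall z, in_square z -> holo_at g z) ->
  (forall z, in_square z -> Cmod (g z) <= M) -> forall k,
  exists gk : C -> C, (forall z, in_square z -> holo_at gk z) /\
    (forall z, in_square z -> Cmod (gk z) <= 3 ^ k * M) /\
    (forall z, (forall i, (i < k)%nat -> z <> RtoC (node i)) -> gk z = div_diff g k z) /\
    (forall z, g z = (match k with O => RtoC 0 | S q => newton_poly g q z end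
                      + gk z * node_prod k z)%C).
Proof.
  intros Hg HM k; induction k as [|k [gk [H1 [H2 [H3 H4]]]]].
  - exists g; split; [auto|split; [intros; simpl; rewrite Rmult_1_l; auto|split; auto]].
    intros z; simpl; ring.
  - destruct (difference_quotient_bound gk (3 ^ k * M) (node k) H1 H2 (node_range k))
      as [g1 [G1 [G2 G3]]].
    assert (E : gk (RtoC (node k)) = newton_coef g k).
    { apply H3; intros i Hi; apply node_inj; lia. }
    exists g1; split; [auto|split; [|split]].
    + intros z Hz; simpl; rewrite Rmult_assoc; auto.
    + intros z Hz; rewrite G3 by (apply Hz; lia).
      rewrite E, H3 by (intros; apply Hz; lia). reflexivity.
    + intros z.
      assert (S : newton_poly g k z
        = (match k with O => RtoC 0 | S q => newton_poly g q z end
           + newton_coef g k * node_prod k z)%C).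
      { destruct k as [|k]; unfold newton_poly.
        - rewrite csum_O; cring.
        - rewrite csum_S; cring. }
      rewrite S, H4, <- E. simpl.
      destruct (excluded_middle_informative (z = RtoC (node k))) as [->|Hz].
      * ring.
      * rewrite G3 by auto. field. now apply Cminus_eq_contra.
Qed.

Lemma newton_coef_bound g M k : (forall z, in_square z -> holo_at g z) ->
  (forall z, in_square z -> Cmod (g z) <= M) -> Cmod (newton_coef g k) <= 3 ^ k * M.
Proof.
  intros Hg HM; destruct (newton_expansion g M Hg HM k) as [gk [_ [H2 [H3 _]]]].
  unfold newton_coef; rewrite <- H3; [apply H2, node_in_square|].
  intros i Hi; apply node_inj; lia.
Qed.

Lemma near_in_square z : Cmod z <= 1 / 16 -> in_square z.
Proof.
  intros H; split; [eapply Rle_trans; [apply re_le_Cmod|lra]|].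
  eapply Rle_trans; [apply im_le_Cmod|lra].
Qed.

Lemma newton_error g M q z : (forall z, in_square z -> holo_at g z) ->
  (forall z, in_square z -> Cmod (g z) <= M) -> Cmod z <= 1 / 16 ->
  Cmod (g z - newton_poly g q z)%C <= M * (3 / 8) ^ S q.
Proof.
  intros Hg HM Hz.
  destruct (newton_expansion g M Hg HM (S q)) as [gk [_ [H2 [_ H4]]]].
  rewrite (H4 z) at 1.
  replace (newton_poly g q z + gk z * node_prod (S q) z - newton_poly g q z)%C
    with (gk z * node_prod (S q) z)%C by ring.
  rewrite Cmod_mult.
  replace (M * (3 / 8) ^ S q) with (3 ^ S q * M * (1 / 8) ^ S q).
  - apply Rmult_le_compat; try apply Cmod_ge_0.
    + apply H2, near_in_square, Hz.
    + now apply node_prod_near.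
  - replace (3 / 8) with (3 * (1 / 8)) by lra. rewrite Rpow_mult_distr; ring.
Qed.

Lemma holo_div_diff (F : C -> C -> C) w :
  (forall z1, in_square z1 -> holo_at (F z1) w) ->
  forall k z1, in_square z1 -> holo_at (fun z2 => div_diff (fun z => F z z2) k z1) w.
Proof.
  intros HF; induction k as [|k IH]; intros z1 Hz1; simpl; [auto|].
  apply holo_at_ext with (r := 1) (g := fun z2 => (/ (z1 - RtoC (node k)) *
     (div_diff (fun z => F z z2) k z1
      - div_diff (fun z => F z z2) k (RtoC (node k))))%C).
  - lra.
  - intros; unfold Cdiv; ring.
  - apply holo_at_scal, holo_at_minus; apply IH; auto; apply node_in_square.
Qed.

Lemma geometric_sum_le X q : 2 <= X -> sum_n (fun k => X ^ k) q <= 2 * X ^ q.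
Proof.
  intros HX; induction q as [|q IH]; [rewrite rsum_O; simpl; lra|].
  rewrite rsum_S; simpl. assert (0 < X ^ q) by (apply pow_lt; lra). nra.
Qed.

Lemma geometric_sum_small X q : 0 <= X <= 1 / 2 -> sum_n (fun k => X ^ k) q <= 2.
Proof.
  intros HX. assert (H : sum_n (fun k => X ^ k) q <= 2 - 2 * X ^ S q).
  { induction q as [|q IH]; [rewrite rsum_O; simpl; lra|].
    rewrite rsum_S. assert (0 <= X ^ S q) by (apply pow_le; lra).
    change (X ^ S (S q)) with (X * X ^ S q). nra. }
  assert (0 <= X ^ S q) by (apply pow_le; lra). lra.
Qed.

(** Interpolation in one variable turns [F] into finitely many Newton coefficients,
    which are linear combinations of values of [F] and hence bounded analytic
    functions of the other variable. *)
Lemma newton_two_variables (F : C -> C -> C) M :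
  (forall z1 z2, in_square z1 -> in_square z2 -> holo_at (fun z => F z z2) z1) ->
  (forall z1 z2, in_square z1 -> in_square z2 -> holo_at (fun z => F z1 z) z2) ->
  (forall z1 z2, in_square z1 -> in_square z2 -> Cmod (F z1 z2) <= M) ->
  forall q, exists T : C -> C -> C,
    (exists a : nat -> C -> C, (forall k, poly1_deg_le q (a k)) /\
       forall z1 z2, T z1 z2 = sum_n (fun k => (node_prod k z1 * a k z2)%C) q) /\
    (forall z1 z2, Cmod z1 <= 1 / 16 -> Cmod z2 <= 1 / 16 ->
       Cmod (F z1 z2 - T z1 z2)%C <= 3 * M * (1 / 2) ^ q) /\
    (forall z1 z2,
       Cmod (T z1 z2) <= 4 * M * (9 * (1 + Cmod z1) * (1 + Cmod z2)) ^ q).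
Proof.
  intros H1 H2 HM q.
  set (A := fun k z2 => newton_coef (fun z => F z z2) k).
  assert (HA : forall k z2, in_square z2 -> holo_at (A k) z2).
  { intros k z2 Hz2; apply (holo_div_diff F); [auto|apply node_in_square]. }
  assert (MA : forall k z2, in_square z2 -> Cmod (A k z2) <= 3 ^ k * M).
  { intros k z2 Hz2; apply newton_coef_bound; auto. }
  assert (HM0 : 0 <= M).
  { eapply Rle_trans; [apply Cmod_ge_0|apply (HM _ _ (node_in_square 0) (node_in_square 0))]. }
  set (T := fun z1 z2 => sum_n (fun k => (node_prod k z1 * newton_poly (A k) q z2)%C) q).
  exists T; split; [|split].
  - exists (fun k => newton_poly (A k) q).
    split; [intros; apply newton_poly_poly1|reflexivity].
  - intros z1 z2 Hz1 Hz2.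
    set (N := newton_poly (fun z => F z z2) q z1).
    assert (E1 : Cmod (F z1 z2 - N)%C <= M * (3 / 8) ^ S q).
    { apply (newton_error (fun z => F z z2)); auto;
        intros; first [apply H1|apply HM]; auto; now apply near_in_square. }
    assert (E2 : Cmod (N - T z1 z2)%C <= 2 * (M * (3 / 8) ^ S q)).
    { replace (N - T z1 z2)%C
        with (sum_n (fun k => node_prod k z1 * (A k z2 - newton_poly (A k) q z2))%C q).
      - apply Rle_trans with (sum_n (fun k => M * (3 / 8) ^ S q * (3 / 8) ^ k) q).
        + apply Cmod_csum; intros k _. rewrite Cmod_mult.
          replace (M * (3 / 8) ^ S q * (3 / 8) ^ k)
            with ((1 / 8) ^ k * (3 ^ k * M * (3 / 8) ^ S q)).
          * apply Rmult_le_compat; try apply Cmod_ge_0; [now apply node_prod_near|].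
            apply newton_error; auto.
          * replace ((3 / 8) ^ k) with (3 ^ k * (1 / 8) ^ k)
              by (rewrite <- Rpow_mult_distr; f_equal; lra). ring.
        + rewrite rsum_mult_l, Rmult_comm.
          apply Rmult_le_compat_r.
          * apply Rmult_le_pos; [auto|apply pow_le; lra].
          * apply geometric_sum_small; lra.
      - unfold N, T, newton_poly at 2.
        match goal with |- _ = (?s - ?t)%C =>
          replace (s - t)%C with (s + - (1) * t)%C by ring end.
        rewrite <- csum_mult_l, <- csum_plus; apply csum_ext; intros k _.
        unfold A; cring. }
    assert (P : (3 / 8) ^ S q <= (1 / 2) ^ q).
    { simpl. assert ((3 / 8) ^ q <= (1 / 2) ^ q) by (apply pow_incr; lra).
      assert (0 <= (3 / 8) ^ q) by (apply pow_le; lra). lra. }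
    replace (F z1 z2 - T z1 z2)%C with ((F z1 z2 - N) + (N - T z1 z2))%C by ring.
    eapply Rle_trans; [apply Cmod_triangle|]. nra.
  - intros z1 z2. assert (P1 := Cmod_ge_0 z1); assert (P2 := Cmod_ge_0 z2).
    set (X := 3 * (1 + Cmod z1)). set (Y := 3 * (1 + Cmod z2)).
    assert (HX : 2 <= X) by (unfold X; lra). assert (HY : 2 <= Y) by (unfold Y; lra).
    assert (BN : forall k, Cmod (newton_poly (A k) q z2) <= 3 ^ k * M * (2 * Y ^ q)).
    { intros k. apply Rle_trans with (sum_n (fun l => 3 ^ k * M * Y ^ l) q).
      - apply Cmod_csum; intros l _. rewrite Cmod_mult.
        replace (3 ^ k * M * Y ^ l) with (3 ^ l * (3 ^ k * M) * (1 + Cmod z2) ^ l)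
          by (unfold Y; rewrite Rpow_mult_distr; ring).
        apply Rmult_le_compat; try apply Cmod_ge_0; [|apply node_prod_growth].
        apply newton_coef_bound; auto.
      - rewrite rsum_mult_l; apply Rmult_le_compat_l; [|now apply geometric_sum_le].
        apply Rmult_le_pos; auto; apply pow_le; lra. }
    apply Rle_trans with (sum_n (fun k => 2 * M * Y ^ q * X ^ k) q).
    + apply Cmod_csum; intros k _. rewrite Cmod_mult.
      replace (2 * M * Y ^ q * X ^ k) with ((1 + Cmod z1) ^ k * (3 ^ k * M * (2 * Y ^ q)))
        by (unfold X; rewrite Rpow_mult_distr; ring).
      apply Rmult_le_compat; try apply Cmod_ge_0; auto using node_prod_growth.
    + rewrite rsum_mult_l.
      replace (4 * M * (9 * (1 + Cmod z1) * (1 + Cmod z2)) ^ q)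
        with (2 * M * Y ^ q * (2 * X ^ q)).
      * apply Rmult_le_compat_l; [|now apply geometric_sum_le].
        apply Rmult_le_pos; [lra|apply pow_le; lra].
      * replace (9 * (1 + Cmod z1) * (1 + Cmod z2)) with (X * Y) by (unfold X, Y; ring).
        rewrite Rpow_mult_distr; ring.
Qed.

(** * Local polynomial approximation *)

(** Geometric approximation near [(c, y0)] by polynomials that grow at most
    geometrically away from it; the neighbourhood has size proportional to [c] in
    the first variable.  One number [e] serves as radius and, inverted, as every
    constant, in the form that [uniform_on_rectangle] asks for. *)
Definition local_approx (f : R -> R -> C) (e c y0 : R) : Prop :=
  forall q, exists T : C -> C -> C, bipoly q T /\
    (forall x y, Pi_set x y -> Rabs (x - c) <= e * c -> Rabs (y - y0) <= e ->
       Cmod (f x y - T (RtoC x) (RtoC y))%C <= / e * (1 / 2) ^ q) /\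
    (forall x y, Pi_set x y ->
       Cmod (T (RtoC x) (RtoC y)) <= / e * (/ e * (1 + x / c)) ^ q).

Lemma local_approx_mono f e e' c y0 : 0 < c -> 0 < e' <= e ->
  local_approx f e c y0 -> local_approx f e' c y0.
Proof.
  intros Hc He H q; destruct (H q) as [T [H0 [H1 H2]]]; exists T; split; [auto|].
  assert (Hi : / e <= / e') by (apply Rinv_le_contravar; lra).
  assert (Hi0 : 0 < / e) by (apply Rinv_0_lt_compat; lra).
  split.
  - intros x y HP Hx Hy. apply Rle_trans with (/ e * (1 / 2) ^ q).
    + apply H1; auto; nra.
    + apply Rmult_le_compat_r; auto; apply pow_le; lra.
  - intros x y HP. apply Rle_trans with (1 := H2 x y HP).
    assert (Hx : 0 <= x / c) by (destruct HP; apply Rlt_le, Rdiv_lt_0_compat; lra).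
    apply Rmult_le_compat; auto; try lra.
    + apply pow_le, Rmult_le_pos; lra.
    + apply pow_incr; split; [apply Rmult_le_pos; lra|].
      apply Rmult_le_compat_r; lra.
Qed.

Lemma small_below (l : list R) :
  exists d, 0 < d /\ forall a, In a l -> 0 < a -> d <= a.
Proof.
  induction l as [|b l [d [Hd H]]].
  - exists 1; split; [lra|easy].
  - destruct (Rle_dec b 0) as [Hb|Hb].
    + exists d; split; auto; intros a [->|Ha] Ha0; [lra|auto].
    + exists (Rmin b d); split; [apply Rmin_glb_lt; lra|].
      intros a [->|Ha] Ha0; [apply Rmin_l|].
      eapply Rle_trans; [apply Rmin_r|auto].
Qed.

Lemma poly1_comp_affine d P (s t : C) : poly1_deg_le d P ->
  poly1_deg_le d (fun z => P (s * (z + t))%C).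
Proof.
  intros [a Ha].
  apply poly1_ext with
    (P := fun z => sum_n (fun k => (a k * Cpow (s * (z + t)) k)%C) d).
  { intros; now rewrite Ha. }
  apply poly1_sum; intros k Hk; apply poly1_scal.
  apply poly1_le with (k * 1)%nat; [lia|].
  apply poly1_pow, poly1_scal, poly1_linear.
Qed.

Lemma Cmod_homog_part a w1 w2 s t n : 0 < s -> Cmod w1 <= t -> Cmod w2 <= t ->
  Cmod (homog_part a w1 w2 n) <= homog_part_abs a (RtoC s) (RtoC s) n * (t / s) ^ n.
Proof.
  intros Hs H1 H2; unfold homog_part, homog_part_abs.
  rewrite Rmult_comm, <- rsum_mult_l.
  apply Cmod_csum; intros k Hk.
  rewrite !Cmod_mult, !Cmod_pow, Cmod_R, Rabs_pos_eq by lra.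
  replace ((t / s) ^ n) with ((t / s) ^ (n - k) * (t / s) ^ k)
    by (rewrite <- pow_add; f_equal; lia).
  replace ((t / s) ^ (n - k) * (t / s) ^ k
    * (Cmod (a (n - k)%nat k) * s ^ (n - k) * s ^ k))
    with (Cmod (a (n - k)%nat k) * (t / s * s) ^ (n - k) * (t / s * s) ^ k)
    by (rewrite !Rpow_mult_distr; ring).
  replace (t / s * s) with t by (field; lra).
  assert (P1 := Cmod_ge_0 w1); assert (P2 := Cmod_ge_0 w2).
  apply Rmult_le_compat; auto using Cmod_ge_0, pow_incr, pow_le.
  - apply Rmult_le_pos; auto using Cmod_ge_0, pow_le.
  - apply Rmult_le_compat_l; auto using Cmod_ge_0, pow_incr.
Qed.

Lemma homog_part_bipoly a (u v : C) n q : (n <= q)%nat ->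
  bipoly q (fun z1 z2 => homog_part a (z1 + u) (z2 + v) n).
Proof.
  intros Hn; unfold homog_part; apply bipoly_sum; intros k Hk.
  apply (bipoly_prod q (fun z1 => a (n - k)%nat k * Cpow (z1 + u) (n - k))%C
    (fun z2 => Cpow (z2 + v) k)).
  - apply poly1_scal, poly1_le with ((n - k) * 1)%nat; [lia|].
    apply poly1_pow, poly1_linear.
  - apply poly1_le with (k * 1)%nat; [lia|]. apply poly1_pow, poly1_linear.
Qed.

(** The double power series at [(u, v)], truncated at total degree [q], serves all
    the nearby centres [(c, y0)] without being re-expanded there. *)
Lemma local_approx_interior f u v : analytic2_on Pi_set f -> Pi_set u v ->
  exists d, 0 < d /\ forall c y0, 0 < c <= 1 -> 0 <= y0 <= 1 ->
    Rabs (c - u) < d -> Rabs (y0 - v) < d -> local_approx f d c y0.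
Proof.
  intros Hf Huv. destruct (Hf u v Huv) as [G [r' [Hr' [[a [r [Hr HG]]] Hagree]]]].
  set (s := r / 2). assert (Hs : 0 < s) by (unfold s; lra).
  assert (HA : exists A, 0 <= A /\ forall n, homog_part_abs a (RtoC s) (RtoC s) n <= A).
  { destruct (HG (RtoC u + RtoC s)%C (RtoC v + RtoC s)%C) as [E _].
    - replace (u + s - u)%C with (RtoC s) by ring.
      rewrite Cmod_R, Rabs_pos_eq; unfold s; lra.
    - replace (v + s - v)%C with (RtoC s) by ring.
      rewrite Cmod_R, Rabs_pos_eq; unfold s; lra.
    - replace (u + s - u)%C with (RtoC s) in E by ring.
      replace (v + s - v)%C with (RtoC s) in E by ring.
      destruct (filterlim_bounded _ (ex_intro _ 0 (ex_series_lim_0 _ E))) as [A HA].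
      change (forall n, Rabs (homog_part_abs a (RtoC s) (RtoC s) n) <= A) in HA.
      exists A; split; [eapply Rle_trans; [apply Rabs_pos|apply (HA O)]|].
      intros n; eapply Rle_trans; [apply Rle_abs|apply (HA n)]. }
  destruct HA as [A [HA0 HA]].
  destruct (small_below [s / 4; r' / 4; r / 4; / (2 * A + 1); / (1 / s + 2)])
    as [d [Hd Hsmall]].
  assert (D1 : d <= s / 4) by (apply Hsmall; [simpl; tauto|lra]).
  assert (D2 : d <= r' / 4) by (apply Hsmall; [simpl; tauto|lra]).
  assert (D3 : d <= r / 4) by (apply Hsmall; [simpl; tauto|lra]).
  assert (D4 : 2 * A + 1 <= / d).
  { rewrite <- (Rinv_inv (2 * A + 1)); apply Rinv_le_contravar; auto.
    apply Hsmall; [simpl; tauto|apply Rinv_0_lt_compat; lra]. }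
  assert (Hs1 : 0 < 1 / s) by (apply Rdiv_lt_0_compat; lra).
  assert (D5 : 1 / s + 2 <= / d).
  { rewrite <- (Rinv_inv (1 / s + 2)); apply Rinv_le_contravar; auto.
    apply Hsmall; [simpl; tauto|apply Rinv_0_lt_compat; lra]. }
  clear Hsmall. exists d; split; auto. intros c y0 Hc Hy0 Hcu Hyv q.
  assert (Hhom : forall x y t n, Rabs (x - u) <= t -> Rabs (y - v) <= t ->
    Cmod (homog_part a (RtoC x - RtoC u) (RtoC y - RtoC v) n) <= A * (t / s) ^ n).
  { intros x y t n Hx Hy.
    eapply Rle_trans; [apply (Cmod_homog_part _ _ _ s t); auto;
      rewrite <- RtoC_minus, Cmod_R; auto|].
    apply Rmult_le_compat_r; auto. apply pow_le.
    assert (H := Rabs_pos (x - u)).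
    apply Rmult_le_pos; [lra|apply Rlt_le, Rinv_0_lt_compat; auto]. }
  exists (fun z1 z2 => sum_n (homog_part a (z1 - RtoC u) (z2 - RtoC v))%C q).
  split; [|split].
  - apply bipoly_sum; intros n Hn; unfold Cminus; now apply homog_part_bipoly.
  - intros x y HP Hx Hy.
    assert (Hx' : Rabs (x - u) <= 2 * d).
    { replace (x - u) with ((x - c) + (c - u)) by ring.
      eapply Rle_trans; [apply Rabs_triang|].
      assert (d * c <= d) by nra. lra. }
    assert (Hy' : Rabs (y - v) <= 2 * d).
    { replace (y - v) with ((y - y0) + (y0 - v)) by ring.
      eapply Rle_trans; [apply Rabs_triang|]. lra. }
    rewrite <- Hagree by (auto; lra).
    destruct (HG (RtoC x) (RtoC y)) as [_ HS].
    + rewrite <- RtoC_minus, Cmod_R; lra.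
    + rewrite <- RtoC_minus, Cmod_R; lra.
    + assert (T := is_series_geometric_tail _ _ A (1 / 2) q HS HA0 ltac:(lra)).
      eapply Rle_trans; [apply T|].
      * intros k. replace (1 / 2) with (s / 2 / s) by (field; lra).
        apply Hhom; lra.
      * replace (2 * A * (1 / 2) ^ S q) with (A * (1 / 2) ^ q) by (simpl; field).
        apply Rmult_le_compat_r; [apply pow_le|]; lra.
  - intros x y HP. destruct HP as [HPx HPy], Huv as [Hu Hv].
    assert (Hxc : 0 < x / c) by (apply Rdiv_lt_0_compat; lra).
    apply Rle_trans with (sum_n (fun n => A * (1 / s + 2) ^ n) q).
    + apply Cmod_csum; intros n _.
      eapply Rle_trans; [apply (Hhom x y 1); apply Rabs_le_between; lra|].
      apply Rmult_le_compat_l; auto. apply pow_incr; lra.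
    + rewrite rsum_mult_l.
      assert (HS := geometric_sum_le (1 / s + 2) q ltac:(lra)).
      assert (P : 0 <= (1 / s + 2) ^ q) by (apply pow_le; lra).
      apply Rle_trans with ((2 * A) * (1 / s + 2) ^ q).
      { rewrite (Rmult_comm 2 A), Rmult_assoc; now apply Rmult_le_compat_l. }
      apply Rmult_le_compat; try lra.
      apply pow_incr; split; [lra|]. nra.
Qed.

(** Newton interpolation on squares of side [c] about [c], which stay inside the
    slit disk. *)
Lemma local_approx_left f h delta y : slit_continuation f h delta y -> 0 < delta ->
  exists d, 0 < d /\ forall c y0, 0 < c <= 1 -> 0 <= y0 <= 1 ->
    Rabs (c - 0) < d -> Rabs (y0 - y) < d -> local_approx f d c y0.
Proof.
  intros [rho [M [F [H [Hrho [HF [HFf [HH [_ HM]]]]]]]]] Hdelta.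
  destruct (holo_at_lipschitz H (RtoC y)) as [K [r [Hr [HK0 HK]]]].
  { apply analytic1_holo, HH. replace (y - y)%C with (RtoC 0) by ring.
    rewrite Cmod_0; auto. }
  (* In the disk of radius [rho2] the function [H] is bounded as well. *)
  set (rho2 := Rmin rho r).
  assert (Hrho2 : 0 < rho2) by now apply Rmin_glb_lt.
  assert (Hrho2' : rho2 <= rho) by apply Rmin_l.
  assert (Hrho2r : rho2 <= r) by apply Rmin_r.
  set (B := Cmod (H (RtoC y)) + K * rho2 + Rabs M * Rpower rho delta).
  assert (HP0 : 0 < Rpower rho delta) by apply exp_pos.
  assert (HB0 : 0 <= B).
  { unfold B. assert (P1 := Cmod_ge_0 (H (RtoC y))). assert (P2 := Rabs_pos M).
    assert (0 <= K * rho2) by nra. assert (0 <= Rabs M * Rpower rho delta) by nra. lra. }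
  assert (HB : forall z1 z2, slit_disk rho z1 -> Cmod (z2 - RtoC y)%C < rho2 ->
    Cmod (F z1 z2) <= B).
  { intros z1 z2 Hz1 Hz2.
    assert (E1 := HM z1 z2 Hz1 ltac:(lra)).
    assert (E2 := HK (z2 - RtoC y)%C ltac:(lra)).
    replace (y + (z2 - y))%C with z2 in E2 by ring.
    replace (F z1 z2) with ((F z1 z2 - H z2) + ((H z2 - H (RtoC y)) + H (RtoC y)))%C by ring.
    eapply Rle_trans; [apply Cmod_triangle|].
    assert (T := Cmod_triangle (H z2 - H (RtoC y)) (H (RtoC y))).
    assert (E3 : M * Rpower (Cmod z1) delta <= Rabs M * Rpower rho delta).
    { apply Rle_trans with (Rabs M * Rpower (Cmod z1) delta).
      - apply Rmult_le_compat_r; [apply Rlt_le, exp_pos|apply Rle_abs].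
      - apply Rmult_le_compat_l; [apply Rabs_pos|].
        destruct Hz1 as [Hz1 Hz1'].
        apply Rle_Rpower_l; [lra|split; [|lra]].
        apply Cmod_gt_0; intros ->; apply Hz1'; simpl; split; [reflexivity|lra]. }
    assert (E4 : K * Cmod (z2 - RtoC y)%C <= K * rho2) by (apply Rmult_le_compat_l; lra).
    unfold B; lra. }
  set (s2 := rho2 / 4). assert (Hs2 : 0 < s2) by (unfold s2; lra).
  assert (Hi2 : 0 < / s2) by now apply Rinv_0_lt_compat.
  destruct (small_below [rho2 / 4; 1 / 32; s2 / 16; / (4 * B + 1); / (27 * (1 + / s2))])
    as [d [Hd Hsmall]].
  assert (D1 : d <= rho2 / 4) by (apply Hsmall; [simpl; tauto|lra]).
  assert (D2 : d <= 1 / 32) by (apply Hsmall; [simpl; tauto|lra]).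
  assert (D3 : d <= s2 / 16) by (apply Hsmall; [simpl; tauto|lra]).
  assert (D4 : 4 * B + 1 <= / d).
  { rewrite <- (Rinv_inv (4 * B + 1)); apply Rinv_le_contravar; auto.
    apply Hsmall; [simpl; tauto|apply Rinv_0_lt_compat; lra]. }
  assert (D5 : 27 * (1 + / s2) <= / d).
  { rewrite <- (Rinv_inv (27 * (1 + / s2))); apply Rinv_le_contravar; auto.
    apply Hsmall; [simpl; tauto|apply Rinv_0_lt_compat; lra]. }
  clear Hsmall. exists d; split; auto. intros c y0 Hc Hy0 Hc' Hy0' q.
  rewrite Rminus_0_r, Rabs_pos_eq in Hc' by lra.
  set (s1 := c / 2). assert (Hs1 : 0 < s1) by (unfold s1; lra).
  assert (Z1 : forall w, in_square w -> slit_disk rho (RtoC c + RtoC s1 * w)%C).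
  { intros w [W1 W2]. split.
    - eapply Rle_lt_trans; [apply Cmod_triangle|].
      assert (L := Cmod_le_abs_sum w).
      rewrite Cmod_mult, !Cmod_R, !Rabs_pos_eq by lra. unfold s1 in *; nra.
    - intros [_ E]. apply Rabs_le_between in W1.
      destruct w as [w1 w2]; simpl in *. unfold s1 in *; nra. }
  assert (Z2 : forall w, in_square w -> Cmod (RtoC y0 + RtoC s2 * w - RtoC y)%C < rho2).
  { intros w [W1 W2].
    replace (y0 + s2 * w - y)%C with (RtoC (y0 - y) + RtoC s2 * w)%C
      by (rewrite RtoC_minus; ring).
    eapply Rle_lt_trans; [apply Cmod_triangle|].
    assert (L := Cmod_le_abs_sum w).
    rewrite Cmod_mult, !Cmod_R, (Rabs_pos_eq s2) by lra. unfold s2 in *; nra. }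
  (* Coordinates in which the two squares become the square of [in_square]. *)
  set (G := fun w1 w2 => F (RtoC c + RtoC s1 * w1)%C (RtoC y0 + RtoC s2 * w2)%C).
  destruct (newton_two_variables G B) with (q := q) as [T [[a [Ta TE]] [T1 T2]]].
  - intros w1 w2 W1 W2.
    apply (holo_at_affine (fun z => F z (RtoC y0 + RtoC s2 * w2)%C)); auto.
    apply analytic1_holo, (analytic2_fst F), HF; auto.
    specialize (Z2 w2 W2); lra.
  - intros w1 w2 W1 W2.
    apply (holo_at_affine (fun z => F (RtoC c + RtoC s1 * w1)%C z)); auto.
    apply analytic1_holo, (analytic2_snd F), HF; auto.
    specialize (Z2 w2 W2); lra.
  - intros w1 w2 W1 W2; apply HB; auto.
  - assert (E1 : forall x, (RtoC (/ s1) * (RtoC x + RtoC (- c)))%C = RtoC ((x - c) / s1)).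
    { intros x; rewrite <- RtoC_plus, <- RtoC_mult; f_equal; unfold Rdiv; ring. }
    assert (E2 : forall x, (RtoC (/ s2) * (RtoC x + RtoC (- y0)))%C = RtoC ((x - y0) / s2)).
    { intros x; rewrite <- RtoC_plus, <- RtoC_mult; f_equal; unfold Rdiv; ring. }
    exists (fun z1 z2 => T (RtoC (/ s1) * (z1 + RtoC (- c)))%C
                           (RtoC (/ s2) * (z2 + RtoC (- y0)))%C).
    split; [|split].
    + apply bipoly_ext with (P := fun z1 z2 => sum_n (fun k =>
        (node_prod k (RtoC (/ s1) * (z1 + RtoC (- c)))
         * a k (RtoC (/ s2) * (z2 + RtoC (- y0))))%C) q).
      { intros; now rewrite TE. }
      apply bipoly_sum; intros k Hk.
      apply (bipoly_prod q (fun z1 => node_prod k (RtoC (/ s1) * (z1 + RtoC (- c)))%C)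
        (fun z2 => a k (RtoC (/ s2) * (z2 + RtoC (- y0)))%C)).
      * apply poly1_comp_affine, poly1_le with k; [auto|apply node_prod_poly1].
      * now apply poly1_comp_affine.
    + intros x y' HP Hx Hy.
      rewrite E1, E2. set (w1 := (x - c) / s1). set (w2 := (y' - y0) / s2).
      assert (W1 : Rabs w1 <= 1 / 16).
      { unfold w1, Rdiv at 1; rewrite Rabs_mult, (Rabs_pos_eq (/ s1))
          by (apply Rlt_le, Rinv_0_lt_compat; lra).
        apply Rmult_le_reg_r with s1; auto.
        rewrite Rmult_assoc, Rinv_l, Rmult_1_r by lra. unfold s1; nra. }
      assert (W2 : Rabs w2 <= 1 / 16).
      { unfold w2, Rdiv at 1; rewrite Rabs_mult, (Rabs_pos_eq (/ s2)) by lra.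
        apply Rmult_le_reg_r with s2; auto.
        rewrite Rmult_assoc, Rinv_l, Rmult_1_r by lra. lra. }
      assert (HG : f x y' = G (RtoC w1) (RtoC w2)).
      { unfold G. rewrite <- !RtoC_mult, <- !RtoC_plus.
        replace (c + s1 * w1) with x by (unfold w1; field; lra).
        replace (y0 + s2 * w2) with y' by (unfold w2; field; lra).
        symmetry; apply HFf; auto.
        - apply Rabs_le_between in Hx; nra.
        - replace (y' - y) with ((y' - y0) + (y0 - y)) by ring.
          eapply Rle_lt_trans; [apply Rabs_triang|]. lra. }
      rewrite HG. eapply Rle_trans; [apply T1; rewrite Cmod_R; auto|].
      apply Rmult_le_compat_r; [apply pow_le|]; lra.
    + intros x y' [HPx HPy]. rewrite E1, E2.
      eapply Rle_trans; [apply T2|].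
      rewrite !Cmod_R.
      assert (Hxc : 0 < x / c) by (apply Rdiv_lt_0_compat; lra).
      assert (W1 : Rabs ((x - c) / s1) <= 2 * (x / c) + 2).
      { replace ((x - c) / s1) with (2 * (x / c) - 2) by (unfold s1; field; lra).
        apply Rabs_le_between; lra. }
      assert (W2 : Rabs ((y' - y0) / s2) <= / s2).
      { unfold Rdiv; rewrite Rabs_mult, (Rabs_pos_eq (/ s2)) by lra.
        rewrite <- (Rmult_1_l (/ s2)) at 2. apply Rmult_le_compat_r; [lra|].
        apply Rabs_le_between; lra. }
      assert (P1 := Rabs_pos ((x - c) / s1)). assert (P2 := Rabs_pos ((y' - y0) / s2)).
      apply Rmult_le_compat; try lra.
      * apply pow_le. apply Rmult_le_pos; lra.
      * apply pow_incr; split; [apply Rmult_le_pos; lra|].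
        apply Rle_trans with (9 * (3 * (1 + x / c)) * (1 + / s2)).
        -- apply Rmult_le_compat; lra.
        -- replace (9 * (3 * (1 + x / c)) * (1 + / s2))
             with (27 * (1 + / s2) * (1 + x / c)) by ring.
           apply Rmult_le_compat_r; lra.
Qed.

Lemma uniform_local_approx f h delta : analytic2_on Pi_set f -> 0 < delta ->
  (forall y, unit_segment y -> slit_continuation f h delta y) ->
  exists e, 0 < e <= 1 / 2 /\
    (forall c y0, 0 < c <= 1 -> 0 <= y0 <= 1 -> local_approx f e c y0) /\
    (forall x y, 0 < x < e -> 0 <= y <= 1 ->
       Cmod (f x y - h y)%C <= / e * Rpower x delta).
Proof.
  intros Hf Hdelta Hleft.
  destruct (uniform_on_rectangle 0 1 0 1 (fun d c y0 => 0 < c -> local_approx f d c y0))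
    as [d1 [Hd1 H1]].
  - intros d d' c y0 Hd H Hc; apply local_approx_mono with d; auto.
  - intros u v [[Hu|<-] Hu1] Hv.
    + destruct (local_approx_interior f u v Hf) as [d [Hd H]]; [split; lra|].
      exists d; split; auto. intros c y0 Hc Hy0 Hcu Hyv Hc0; apply H; auto; lra.
    + destruct (local_approx_left f h delta v (Hleft v Hv) Hdelta) as [d [Hd H]].
      exists d; split; auto. intros c y0 Hc Hy0 Hcu Hyv Hc0; apply H; auto; lra.
  - destruct (uniform_on_rectangle 0 1 0 1 (fun d _ y => forall x, 0 < x < d -> x <= 1 ->
      Cmod (f x y - h y)%C <= / d * Rpower x delta)) as [d2 [Hd2 H2]].
    + intros d d' _ y Hd H x Hx Hx1. apply Rle_trans with (/ d * Rpower x delta).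
      * apply H; lra.
      * apply Rmult_le_compat_r; [apply Rlt_le, exp_pos|].
        apply Rinv_le_contravar; lra.
    + intros u v _ Hv.
      destruct (Hleft v Hv) as [rho [M [F [H [Hrho [_ [HFf [_ [HHh HM]]]]]]]]].
      assert (PM := Rabs_pos M).
      destruct (small_below [rho; / (Rabs M + 1)]) as [d [Hd Hsmall]].
      assert (D1 : d <= rho) by (apply Hsmall; [simpl; tauto|lra]).
      assert (D2 : Rabs M + 1 <= / d).
      { rewrite <- (Rinv_inv (Rabs M + 1)); apply Rinv_le_contravar; auto.
        apply Hsmall; [simpl; tauto|apply Rinv_0_lt_compat; lra]. }
      exists d; split; auto. intros _ y _ Hy _ Hyv x Hx Hx1.
      rewrite <- HFf, <- HHh by (try split; lra).
      eapply Rle_trans; [apply HM|].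
      * split; [rewrite Cmod_R, Rabs_pos_eq; lra|]. simpl; lra.
      * rewrite <- RtoC_minus, Cmod_R; lra.
      * rewrite Cmod_R, Rabs_pos_eq by lra.
        apply Rmult_le_compat_r; [apply Rlt_le, exp_pos|].
        assert (H0 := Rle_abs M); lra.
    + exists (Rmin (1 / 2) (Rmin d1 d2)).
      assert (M1 := Rmin_l (1 / 2) (Rmin d1 d2)); assert (M2 := Rmin_r (1 / 2) (Rmin d1 d2)).
      assert (M3 := Rmin_l d1 d2); assert (M4 := Rmin_r d1 d2).
      assert (M0 : 0 < Rmin (1 / 2) (Rmin d1 d2)) by (repeat apply Rmin_glb_lt; lra).
      split; [lra|split].
      * intros c y0 Hc Hy0; apply local_approx_mono with d1; try lra. apply H1; lra.
      * intros x y Hx Hy. apply Rle_trans with (/ d2 * Rpower x delta).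
        -- apply (H2 0 y); lra.
        -- apply Rmult_le_compat_r; [apply Rlt_le, exp_pos|].
           apply Rinv_le_contravar; lra.
Qed.

(** * The global estimate *)

(** One power of [growth x c] absorbs the growth of the local approximants, for all
    [x] away from the peak [c]: close to [c] because [growth x c] is bounded below by
    a number greater than 1, and far from it because its square is comparable with
    [x / c]. *)
Lemma growth_dominates e : 0 < e <= 1 / 2 -> exists p, (1 <= p)%nat /\
  forall x c, 0 < x -> 0 < c -> e * c < Rabs (x - c) ->
    1 <= growth x c /\ / e * (1 + x / c) <= growth x c ^ p /\ 16 <= growth x c ^ p.
Proof.
  intros He. set (B0 := 1 + 4 / 225 * (e * e)).
  assert (HB0 : 1 < B0) by (unfold B0; nra).
  assert (Hie : 2 <= / e).
  { rewrite <- (Rinv_inv 2); apply Rinv_le_contravar; lra. }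
  destruct (Pow_x_infinity B0 ltac:(rewrite Rabs_pos_eq; lra) (80 * / e)) as [p0 Hp0].
  specialize (Hp0 p0 ltac:(lia)).
  rewrite Rabs_pos_eq in Hp0 by (apply pow_le; lra).
  exists (p0 + 2)%nat; split; [lia|]; intros x c Hx Hc Hxc.
  assert (HB := growth_far e x c ltac:(lra) Hx Hc Hxc). fold B0 in HB.
  assert (HG := growth_large x c Hx Hc).
  assert (Hxc0 : 0 < x / c) by (apply Rdiv_lt_0_compat; lra).
  set (B := growth x c) in *.
  assert (HBp : 80 * / e <= B ^ p0).
  { apply Rge_le in Hp0; apply Rle_trans with (1 := Hp0). apply pow_incr; lra. }
  assert (E : B ^ (p0 + 2) = B ^ p0 * (B * B)) by (rewrite pow_add; simpl; ring).
  assert (HBB : 1 <= B * B) by nra.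
  rewrite E; split; [lra|split; [|nra]].
  destruct (Rle_dec x c) as [H|H].
  - assert (x / c <= 1).
    { apply Rmult_le_reg_r with c; auto. unfold Rdiv; rewrite Rmult_assoc, Rinv_l; lra. }
    nra.
  - assert (1 <= x / c).
    { apply Rmult_le_reg_r with c; auto. unfold Rdiv; rewrite Rmult_assoc, Rinv_l; lra. }
    apply Rle_trans with (80 * / e * (B * B)); [|nra].
    replace (80 * / e * (B * B)) with (/ e * (2 * (40 * (B * B)))) by ring.
    apply Rmult_le_compat_l; lra.
Qed.

(** Of the factors [B] in [B ^ m], [p * q] pay for [X ^ q] and another [p * q] supply
    the gain [16 ^ q]. *)
Lemma decay_beats_growth w B X p q m : 0 <= w -> 1 <= B -> 0 <= X ->
  X <= B ^ p -> 16 <= B ^ p -> (2 * p * q <= m)%nat -> w * B ^ m <= 1 ->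
  w * X ^ q <= (1 / 16) ^ q.
Proof.
  intros Hw HB HX HXB H16 Hm H.
  assert (H1 : X ^ q <= B ^ (p * q)).
  { rewrite pow_mult; apply pow_incr; lra. }
  assert (H2 : 16 ^ q <= B ^ (p * q)).
  { rewrite pow_mult; apply pow_incr; lra. }
  assert (H3 : B ^ (p * q) * B ^ (p * q) <= B ^ m).
  { rewrite <- pow_add; apply Rle_pow; [auto|lia]. }
  assert (P16 : 0 < 16 ^ q) by (apply pow_lt; lra).
  assert (PX : 0 <= X ^ q) by (apply pow_le; lra).
  apply Rmult_le_reg_r with (16 ^ q); auto.
  replace ((1 / 16) ^ q * 16 ^ q) with 1
    by (rewrite <- Rpow_mult_distr; replace (1 / 16 * 16) with 1 by lra; now rewrite pow1).
  apply Rle_trans with (w * (X ^ q * 16 ^ q)); [lra|].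
  apply Rle_trans with (w * B ^ m); auto.
  apply Rmult_le_compat_l; auto.
  apply Rle_trans with (B ^ (p * q) * B ^ (p * q)); auto.
  apply Rmult_le_compat; lra.
Qed.

Section GlobalEstimate.

Variables (f : R -> R -> C) (h : R -> C) (delta e : R) (p p' : nat).
Hypothesis delta_pos : 0 < delta.
Hypothesis e_range : 0 < e <= 1 / 2.
Hypothesis f_local : forall c y0, 0 < c <= 1 -> 0 <= y0 <= 1 -> local_approx f e c y0.
Hypothesis f_trace : forall x y, 0 < x < e -> 0 <= y <= 1 ->
  Cmod (f x y - h y)%C <= / e * Rpower x delta.
Hypothesis p_growth : forall x c, 0 < x -> 0 < c -> e * c < Rabs (x - c) ->
  1 <= growth x c /\ / e * (1 + x / c) <= growth x c ^ p /\ 16 <= growth x c ^ p.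
Hypothesis p'_decay : (1 - e * e / 4) ^ p' * (3 * / e) <= 1 / 16.

Variables (b : nat -> R) (n m q : nat) (tau : R).
Hypothesis b_pos : forall i, 0 < b i.
Hypothesis b_inj : forall i j, b i = b j -> i = j.
Hypothesis tau_range : 0 < tau /\ 4 * tau < e.
Hypothesis m_large : (2 * p * q <= m)%nat.
Hypothesis poles_dense : forall g, tau <= g <= 1 -> exists i0, (i0 + m <= n)%nat /\
  forall i, (i0 <= i < i0 + m)%nat -> g / 4 <= b i <= g.

Let L := (p' * q)%nat.

Definition near_error : R := / e * (1 / 2) ^ q + 2 * / e * Rpower (4 * tau) delta.

Definition far_error : R := 3 * / e * (1 / 16) ^ q.

Lemma inv_e_ge2 : 2 <= / e.
Proof. rewrite <- (Rinv_inv 2); apply Rinv_le_contravar; lra. Qed.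

Lemma f_bounded x y : Pi_set x y -> Cmod (f x y) <= 2 * / e.
Proof.
  intros HP. destruct (f_local x y (proj1 HP) (proj2 HP) O) as [T [_ [H1 H2]]].
  destruct HP as [Hx Hy].
  specialize (H1 x y ltac:(split; auto)); specialize (H2 x y ltac:(split; auto)).
  replace (x - x) with 0 in H1 by ring. replace (y - y) with 0 in H1 by ring.
  rewrite Rabs_R0 in H1. specialize (H1 ltac:(nra) ltac:(lra)). simpl in H1, H2.
  replace (f x y) with ((f x y - T (RtoC x) (RtoC y)) + T (RtoC x) (RtoC y))%C by ring.
  eapply Rle_trans; [apply Cmod_triangle|]. lra.
Qed.

Lemma error_bounded x y t X : Pi_set x y -> 1 <= X -> Cmod t <= / e * X ^ q ->
  Cmod (f x y - t)%C <= 3 * / e * X ^ q.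
Proof.
  intros HP HX Ht. assert (H := f_bounded x y HP). assert (Hi := inv_e_ge2).
  assert (HX' : 1 <= X ^ q) by now apply pow_R1_Rle.
  eapply Rle_trans; [apply Cmod_triangle|]. rewrite Cmod_opp. nra.
Qed.

Lemma near_error_ge0 : 0 <= near_error.
Proof.
  assert (Hi := inv_e_ge2). unfold near_error.
  assert (0 <= (1 / 2) ^ q) by (apply pow_le; lra).
  assert (0 < Rpower (4 * tau) delta) by apply exp_pos. nra.
Qed.

Lemma far_error_ge0 : 0 <= far_error.
Proof.
  assert (Hi := inv_e_ge2). unfold far_error.
  assert (0 <= (1 / 16) ^ q) by (apply pow_le; lra). nra.
Qed.

Lemma far_in_y l c y x k t : (k <= n)%nat -> (l <= L)%nat ->
  (forall y, 0 <= y <= 1 -> bern L l y <= (1 - (y - c) * (y - c) / 4) ^ L) ->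
  Pi_set x y -> 0 <= c <= 1 -> e < Rabs (y - c) -> Cmod t <= / e * (3 * / e) ^ q ->
  weight b n k x * bern L l y * Cmod (f x y - t)%C <= far_error.
Proof.
  intros Hk Hl Hb HP Hc Hyc Ht. assert (Hi := inv_e_ge2).
  assert (HE := error_bounded x y t (3 * / e) HP ltac:(lra) Ht).
  destruct HP as [Hx Hy].
  assert (Hw := weight_ge0 b b_pos n k x ltac:(lra)).
  assert (Hw1 := weight_le1 b b_pos n k x Hk ltac:(lra)).
  assert (Hb0 := bern_ge0 L l y Hy). specialize (Hb y Hy).
  assert (Hsq : e * e <= (y - c) * (y - c) <= 1).
  { revert Hyc; unfold Rabs; destruct (Rcase_abs (y - c)); intros; nra. }
  assert (Hb1 : bern L l y <= ((1 - e * e / 4) ^ p') ^ q).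
  { apply Rle_trans with (1 := Hb). rewrite <- pow_mult. apply pow_incr; lra. }
  apply Rle_trans with (1 * ((1 - e * e / 4) ^ p') ^ q * (3 * / e * (3 * / e) ^ q)).
  - apply Rmult_le_compat; try apply Cmod_ge_0; auto.
    + now apply Rmult_le_pos.
    + now apply Rmult_le_compat.
  - unfold far_error.
    replace (1 * ((1 - e * e / 4) ^ p') ^ q * (3 * / e * (3 * / e) ^ q))
      with (3 * / e * ((1 - e * e / 4) ^ p' * (3 * / e)) ^ q)
      by (rewrite Rpow_mult_distr; ring).
    apply Rmult_le_compat_l; [lra|]. apply pow_incr; split; auto.
    apply Rmult_le_pos; [apply pow_le|]; nra.
Qed.

Lemma far_in_x l x y k X t : (l <= L)%nat -> Pi_set x y -> 1 <= X ->
  weight b n k x * X ^ q <= (1 / 16) ^ q -> Cmod t <= / e * X ^ q ->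
  weight b n k x * bern L l y * Cmod (f x y - t)%C <= far_error.
Proof.
  intros Hl HP HX HwX Ht. assert (Hi := inv_e_ge2).
  assert (HE := error_bounded x y t X HP HX Ht).
  destruct HP as [Hx Hy].
  assert (Hw := weight_ge0 b b_pos n k x ltac:(lra)).
  assert (Hb0 := bern_ge0 L l y Hy). assert (Hb1 := bern_le1 L l y Hl Hy).
  apply Rle_trans with (weight b n k x * 1 * (3 * / e * X ^ q)).
  - apply Rmult_le_compat; try apply Cmod_ge_0; auto.
    + now apply Rmult_le_pos.
    + now apply Rmult_le_compat_l.
  - unfold far_error. replace (weight b n k x * 1 * (3 * / e * X ^ q))
      with (3 * / e * (weight b n k x * X ^ q)) by ring.
    apply Rmult_le_compat_l; [lra|auto].
Qed.

Lemma weight_far x c k : (k <= n)%nat -> 0 < x -> 0 < c -> e * c < Rabs (x - c) ->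
  tau <= sqrt (x * c) <= 1 ->
  weight b n k (sqrt (x * c)) <= weight b n k c ->
  weight b n k x * (/ e * (1 + x / c)) ^ q <= (1 / 16) ^ q.
Proof.
  intros Hk Hx Hc Hxc Hg Hmax.
  destruct (poles_dense _ Hg) as [i0 [Hi0 Hb]].
  destruct (p_growth x c Hx Hc Hxc) as [G1 [G2 G3]].
  assert (Hxc0 : 0 < x / c) by (apply Rdiv_lt_0_compat; lra).
  assert (Hi := inv_e_ge2).
  apply decay_beats_growth with (growth x c) p m; auto.
  - apply weight_ge0; auto; lra.
  - apply Rmult_le_pos; lra.
  - now apply weight_decay with i0.
Qed.

(** The approximant attached to a pair of weights is the local one at their peaks.
    For the weights that peak below [2 * tau] the first variable is frozen at
    [2 * tau]: there [f] is as close to its boundary values as required. *)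
Lemma term_estimate k l : (k <= n)%nat -> (l <= L)%nat ->
  exists T : C -> C -> C, bipoly q T /\ forall x y, Pi_set x y ->
    weight b n k x * bern L l y * Cmod (f x y - T (RtoC x) (RtoC y))%C
    <= weight b n k x * bern L l y * near_error + far_error.
Proof.
  intros Hk Hl. destruct tau_range as [Ht0 Hte]. assert (Hi := inv_e_ge2).
  destruct (weight_peak b b_pos n k Hk) as [c [Hc [Hcpos Hcmax]]].
  destruct (bern_decay L l Hl) as [y0 [Hy0 Hby]].
  assert (NE := near_error_ge0). assert (FE := far_error_ge0).
  assert (Hnear : forall x y t, Pi_set x y -> Cmod (f x y - t)%C <= near_error ->
    weight b n k x * bern L l y * Cmod (f x y - t)%C
    <= weight b n k x * bern L l y * near_error + far_error).
  { intros x y t [Hx Hy] H.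
    assert (Hw := weight_ge0 b b_pos n k x ltac:(lra)).
    assert (Hb0 := bern_ge0 L l y Hy).
    assert (weight b n k x * bern L l y * Cmod (f x y - t)%C
      <= weight b n k x * bern L l y * near_error); [|lra].
    apply Rmult_le_compat_l; auto; now apply Rmult_le_pos. }
  assert (Hfar : forall x y t, Pi_set x y ->
    weight b n k x * bern L l y * Cmod (f x y - t)%C <= far_error ->
    weight b n k x * bern L l y * Cmod (f x y - t)%C
    <= weight b n k x * bern L l y * near_error + far_error).
  { intros x y t [Hx Hy] H.
    assert (Hw := weight_ge0 b b_pos n k x ltac:(lra)).
    assert (Hb0 := bern_ge0 L l y Hy).
    assert (0 <= weight b n k x * bern L l y * near_error); [|lra].
    apply Rmult_le_pos; auto; now apply Rmult_le_pos. }
  assert (Hsqrt : forall s t, 0 < s -> 0 < t ->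
    Rmin s t <= sqrt (s * t) <= Rmax s t).
  { intros s t Hs Ht. assert (M1 : 0 < Rmin s t) by now apply Rmin_glb_lt.
    assert (M2 : 0 < Rmax s t) by (apply Rlt_le_trans with s; [auto|apply Rmax_l]).
    rewrite <- (sqrt_square (Rmin s t)), <- (sqrt_square (Rmax s t)) by lra.
    split; apply sqrt_le_1_alt; apply Rmult_le_compat; try lra;
      first [apply Rmin_l|apply Rmin_r|apply Rmax_l|apply Rmax_r]. }
  destruct (Rle_dec c (2 * tau)) as [Hctau|Hctau].
  - destruct (f_local (2 * tau) y0 ltac:(lra) Hy0 q) as [T [T0 [T1 T2]]].
    exists (fun _ z2 => T (RtoC (2 * tau)) z2); split; [now apply bipoly_freeze|].
    intros x y HP. destruct (HP) as [Hx Hy].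
    assert (HP' : Pi_set (2 * tau) y) by (split; lra).
    assert (B2 := T2 _ _ HP').
    replace (2 * tau / (2 * tau)) with 1 in B2 by (field; lra).
    destruct (Rle_dec x (4 * tau)) as [Hx4|Hx4].
    + destruct (Rle_dec (Rabs (y - y0)) e) as [Hyy|Hyy].
      * apply Hnear; auto.
        specialize (T1 _ _ HP'). replace (2 * tau - 2 * tau) with 0 in T1 by ring.
        rewrite Rabs_R0 in T1. specialize (T1 ltac:(nra) Hyy).
        assert (F1 := f_trace x y ltac:(lra) Hy).
        assert (F2 := f_trace (2 * tau) y ltac:(lra) Hy).
        assert (R1 : Rpower x delta <= Rpower (4 * tau) delta) by (apply Rle_Rpower_l; lra).
        assert (R2 : Rpower (2 * tau) delta <= Rpower (4 * tau) delta)
          by (apply Rle_Rpower_l; lra).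
        replace (f x y - T (2 * tau)%R y)%C
          with ((f x y - h y) + (- (f (2 * tau)%R y - h y)
                + (f (2 * tau)%R y - T (2 * tau)%R y)))%C by ring.
        eapply Rle_trans; [apply Cmod_triangle|].
        assert (Q := Cmod_triangle (- (f (2 * tau)%R y - h y))%C
          (f (2 * tau)%R y - T (2 * tau)%R y)%C).
        rewrite Cmod_opp in Q. unfold near_error.
        assert (/ e * Rpower x delta <= / e * Rpower (4 * tau) delta)
          by (apply Rmult_le_compat_l; lra).
        assert (/ e * Rpower (2 * tau) delta <= / e * Rpower (4 * tau) delta)
          by (apply Rmult_le_compat_l; lra).
        lra.
      * apply Hfar; auto. apply far_in_y with y0; auto; [lra|].
        apply Rle_trans with (1 := B2). apply Rmult_le_compat_l; [lra|].
        apply pow_incr; lra.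
    + (* The weight decreases to the right of [c <= 2 * tau], so [2 * tau] can play
         the part of the peak. *)
      apply Hfar; auto. apply Rnot_le_lt in Hx4.
      assert (Hg := Hsqrt x (2 * tau) ltac:(lra) ltac:(lra)).
      rewrite Rmin_right, Rmax_left in Hg by lra.
      assert (Hx2 : 1 <= x / (2 * tau)).
      { apply Rmult_le_reg_r with (2 * tau); [lra|].
        unfold Rdiv; rewrite Rmult_assoc, Rinv_l; lra. }
      apply far_in_x with (/ e * (1 + x / (2 * tau))); auto.
      * nra.
      * apply weight_far; auto; try lra.
        -- rewrite Rabs_pos_eq by lra. nra.
        -- apply weight_unimodal with (c := c); auto; lra.
      * apply Rle_trans with (1 := B2). apply Rmult_le_compat_l; [lra|].
        apply pow_incr; split; nra.
  - apply Rnot_le_lt in Hctau.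
    destruct (f_local c y0 ltac:(lra) Hy0 q) as [T [T0 [T1 T2]]].
    exists T; split; [auto|]. intros x y HP. destruct (HP) as [Hx Hy].
    specialize (T1 x y HP); specialize (T2 x y HP).
    assert (Hxc0 : 0 < x / c) by (apply Rdiv_lt_0_compat; lra).
    destruct (Rle_dec (Rabs (x - c)) (e * c)) as [Hxc|Hxc].
    + destruct (Rle_dec (Rabs (y - y0)) e) as [Hyy|Hyy].
      * apply Hnear; auto. apply Rle_trans with (1 := T1 Hxc Hyy).
        unfold near_error. assert (0 < Rpower (4 * tau) delta) by apply exp_pos. nra.
      * apply Hfar; auto. apply far_in_y with y0; auto; [lra|].
        apply Rle_trans with (1 := T2). apply Rmult_le_compat_l; [lra|].
        assert (x / c <= 2).
        { apply Rmult_le_reg_r with c; [lra|].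
          unfold Rdiv; rewrite Rmult_assoc, Rinv_l by lra.
          apply Rabs_le_between in Hxc; nra. }
        apply pow_incr; split; nra.
    + apply Hfar; auto. apply Rnot_le_lt in Hxc.
      apply far_in_x with (/ e * (1 + x / c)); auto; [nra|].
      destruct (Rle_dec tau x) as [Htx|Htx].
      * assert (Hg := Hsqrt x c ltac:(lra) ltac:(lra)).
        assert (M1 : tau <= Rmin x c) by (apply Rmin_glb; lra).
        assert (M2 : Rmax x c <= 1) by (apply Rmax_lub; lra).
        apply weight_far; auto; try lra. apply Hcmax; lra.
      * (* The geometric mean of [x] and [c] may lie below the poles; but left of the
           peak the weight is smaller than at [tau]. *)
        assert (Hg := Hsqrt tau c ltac:(lra) ltac:(lra)).
        rewrite Rmin_left, Rmax_right in Hg by lra.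
        assert (W : weight b n k tau * (/ e * (1 + tau / c)) ^ q <= (1 / 16) ^ q).
        { apply weight_far; auto; try lra.
          - rewrite Rabs_left by lra. nra.
          - apply Hcmax; lra. }
        apply Rle_trans with (2 := W).
        apply Rmult_le_compat.
        -- apply weight_ge0; auto; lra.
        -- apply pow_le, Rmult_le_pos; lra.
        -- apply weight_unimodal with (c := c); auto; lra.
        -- apply pow_incr; split; [apply Rmult_le_pos; lra|].
           apply Rmult_le_compat_l; [lra|]. apply Rplus_le_compat_l.
           apply Rmult_le_compat_r; [apply Rlt_le, Rinv_0_lt_compat|]; lra.
Qed.

Lemma rational_approximation : exists g : R -> R -> C,
  has_rational_form b n (q + (q + L)) g /\ forall x y, Pi_set x y ->
    Cmod (f x y - g x y)%C
    <= near_error + INR (S n) * (INR (S L) * far_error).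
Proof.
  assert (H : forall k l, exists T : C -> C -> C,
    (k <= n)%nat -> (l <= L)%nat -> bipoly q T /\ forall x y, Pi_set x y ->
    weight b n k x * bern L l y * Cmod (f x y - T (RtoC x) (RtoC y))%C
    <= weight b n k x * bern L l y * near_error + far_error).
  { intros k l. destruct (classic ((k <= n)%nat /\ (l <= L)%nat)) as [[Hk Hl]|N].
    - destruct (term_estimate k l Hk Hl) as [T HT]; exists T; auto.
    - exists (fun _ _ => RtoC 0); intros; tauto. }
  set (T := fun k l => proj1_sig (constructive_indefinite_description _ (H k l))).
  assert (HT : forall k l, (k <= n)%nat -> (l <= L)%nat ->
    bipoly q (T k l) /\ forall x y, Pi_set x y ->
    weight b n k x * bern L l y * Cmod (f x y - T k l (RtoC x) (RtoC y))%C
    <= weight b n k x * bern L l y * near_error + far_error).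
  { intros k l; exact (proj2_sig (constructive_indefinite_description _ (H k l))). }
  clearbody T; clear H.
  set (t := fun k l x y =>
    (RtoC (weight b n k x) * RtoC (bern L l y) * T k l (RtoC x) (RtoC y))%C).
  exists (fun x y => sum_n (fun k => sum_n (fun l => t k l x y) L) n); split.
  - apply (hrf_sum b n _ (fun k x y => sum_n (fun l => t k l x y) L)); intros k Hk.
    apply (hrf_sum b n _ (fun l x y => t k l x y)); intros l Hl.
    set (Q := fun z => (RtoC (Binomial.C L l) * (Cpow z l * Cpow (- (1) * (z + - (1))) (L - l)))%C).
    apply hrf_ext with (g := fun x y => (RtoC (ecoef b n k) *
      (RtoC (x ^ k / denom b n x) * Q (RtoC y) * T k l (RtoC x) (RtoC y)))%C).
    + intros x y Hx. unfold t, weight, bern, Q.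
      rewrite !RtoC_mult, <- !RtoC_pow. rewrite !RtoC_pow, RtoC_minus.
      replace (- (1) * (y + - (1)))%C with (1 - y)%C by ring. ring.
    + apply hrf_scal, hrf_weight_bipoly with q L; auto.
      * now apply HT.
      * unfold Q; apply poly1_scal.
        replace L with (l + (L - l))%nat at 1 by lia. apply poly1_monomial.
        apply poly1_le with ((L - l) * 1)%nat; [lia|].
        apply poly1_pow, poly1_scal, poly1_linear.
  - intros x y HP. destruct (HP) as [Hx Hy].
    assert (E : (f x y - sum_n (fun k => sum_n (fun l => t k l x y) L) n)%C
      = sum_n (fun k => sum_n (fun l => RtoC (weight b n k x) * RtoC (bern L l y)
          * (f x y - T k l (RtoC x) (RtoC y)))%C L) n).
    { assert (U : forall (a : nat -> R) N,
        sum_n (fun k => RtoC (a k)) N = RtoC (sum_n a N)).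
      { intros a N; induction N as [|N IH]; [now rewrite csum_O, rsum_O|].
        now rewrite csum_S, rsum_S, IH, RtoC_plus. }
      transitivity (sum_n (fun k => RtoC (weight b n k x) * f x y
        + - (1) * sum_n (fun l => t k l x y) L)%C n).
      - rewrite csum_plus, csum_mult_l.
        assert (E1 : sum_n (fun k => RtoC (weight b n k x) * f x y)%C n = f x y).
        { transitivity (sum_n (fun k => f x y * RtoC (weight b n k x))%C n).
          - apply csum_ext; intros; cring.
          - rewrite csum_mult_l, U, weight_sum by (auto; lra). cring. }
        rewrite E1. cring.
      - apply csum_ext; intros k Hk.
        transitivity (sum_n (fun l => (RtoC (weight b n k x) * f x y) * RtoC (bern L l y)
          + - (1) * t k l x y)%C L).
        + rewrite csum_plus, !csum_mult_l, U, bern_sum. cring.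
        + apply csum_ext; intros l Hl; unfold t; cring. }
    rewrite E. clear E.
    apply Rle_trans with (sum_n (fun k => sum_n (fun l =>
      weight b n k x * bern L l y * near_error + far_error) L) n).
    + apply Cmod_csum; intros k Hk. apply Cmod_csum; intros l Hl.
      rewrite !Cmod_mult, !Cmod_R, !Rabs_pos_eq.
      * now apply HT.
      * now apply bern_ge0.
      * apply weight_ge0; auto; lra.
    + apply Req_le.
      transitivity (sum_n (fun k => near_error * weight b n k x
        + INR (S L) * far_error) n).
      * apply rsum_ext; intros k Hk.
        rewrite (rsum_ext _ (fun l => (weight b n k x * near_error) * bern L l y
          + far_error)) by (intros; rring).
        rewrite rsum_plus, rsum_mult_l, rsum_const, bern_sum. rring.
      * rewrite rsum_plus, rsum_mult_l, rsum_const, weight_sum by (auto; lra). rring.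
Qed.

End GlobalEstimate.

(** * Root-exponential convergence *)

(** The logarithms of the poles are spaced by [eta]; a run of [m] of them below
    [ln g] covers a length of at most 1, which is less than [ln 4].  The last
    hypothesis says that the poles reach far enough below [tau]. *)
Lemma exp_poles_dense rad eta tau n m : 1 <= rad -> 0 < eta -> 0 < tau <= 1 ->
  INR m * eta <= 1 -> ln (rad / tau) + eta + 1 <= eta * INR n ->
  forall g, tau <= g <= 1 -> exists i0, (i0 + m <= n)%nat /\
    forall i, (i0 <= i < i0 + m)%nat ->
      g / 4 <= rad * exp (- (eta * INR i)) <= g.
Proof.
  intros Hrad Heta Htau Hm Hn g Hg.
  assert (Hlg : 0 <= ln (rad / g)).
  { rewrite <- ln_1. apply ln_le; [lra|].
    apply Rmult_le_reg_r with g; [lra|]. unfold Rdiv; rewrite Rmult_assoc, Rinv_l; lra. }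
  assert (Hlt : ln (rad / g) <= ln (rad / tau)).
  { apply ln_le; [apply Rdiv_lt_0_compat; lra|].
    apply Rmult_le_compat_l; [lra|apply Rinv_le_contravar; lra]. }
  assert (Eg : exp (ln (rad / g)) = rad / g)
    by (apply exp_ln, Rdiv_lt_0_compat; lra).
  set (lam := ln (rad / g)) in *.
  destruct (nfloor_ex (lam / eta)) as [j [Hj1 Hj2]].
  { apply Rmult_le_pos; [auto|apply Rlt_le, Rinv_0_lt_compat; auto]. }
  assert (Hj1' : INR j * eta <= lam).
  { apply Rmult_le_reg_r with (/ eta); [now apply Rinv_0_lt_compat|].
    rewrite Rmult_assoc, Rinv_r by lra. unfold Rdiv in Hj1; lra. }
  assert (Hj2' : lam < (INR j + 1) * eta).
  { apply Rmult_lt_reg_r with (/ eta); [now apply Rinv_0_lt_compat|].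
    rewrite Rmult_assoc, Rinv_r by lra. unfold Rdiv in Hj2; lra. }
  exists (S j); split.
  - apply INR_le. rewrite plus_INR, S_INR.
    apply Rmult_le_reg_l with eta; auto. lra.
  - intros i [Hi1 Hi2].
    assert (I1 : INR j + 1 <= INR i) by (rewrite <- S_INR; now apply le_INR).
    assert (I2 : INR i <= INR j + INR m) by (rewrite <- plus_INR; apply le_INR; lia).
    assert (X1 : exp (- (eta * INR i)) <= g / rad).
    { replace (g / rad) with (/ exp lam) by (rewrite Eg; field; lra).
      rewrite <- exp_Ropp. apply Rlt_le, exp_increasing. nra. }
    assert (X2 : g / rad / 4 <= exp (- (eta * INR i))).
    { apply Rle_trans with (exp (- (lam + 1))).
      - replace (- (lam + 1)) with (- lam + - (1)) by ring.
        rewrite exp_plus, !exp_Ropp, Eg. replace (/ (rad / g)) with (g / rad) by (field; lra).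
        apply Rmult_le_compat_l; [apply Rlt_le, Rdiv_lt_0_compat; lra|].
        assert (E3 := exp_le_3). assert (E0 := exp_pos 1).
        apply Rinv_le_contravar; lra.
      - destruct (Rle_lt_or_eq_dec (eta * INR i) (lam + 1)) as [H|H].
        + nra.
        + apply Rlt_le, exp_increasing; lra.
        + rewrite H; lra. }
    split.
    + replace (g / 4) with (rad * (g / rad / 4)) by (field; lra).
      apply Rmult_le_compat_l; lra.
    + apply Rle_trans with (rad * (g / rad)); [|apply Req_le; field; lra].
      apply Rmult_le_compat_l; lra.
Qed.

Lemma INR_S_le_pow2 q : INR q + 1 <= 2 ^ q.
Proof.
  induction q as [|q IH]; [simpl; lra|].
  rewrite S_INR; simpl. assert (H := pos_INR q). lra.
Qed.

Lemma half_pow_le_exp q N a : 0 < a -> N <= a * (INR q + 1) ->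
  (1 / 2) ^ q <= 2 * exp (- (N / (2 * a))).
Proof.
  intros Ha H.
  assert (E : 1 / 2 <= exp (- (1 / 2))).
  { rewrite exp_Ropp. unfold Rdiv at 1; rewrite Rmult_1_l.
    apply Rinv_le_contravar; [apply exp_pos|].
    assert (E3 := exp_le_3). assert (E0 := exp_pos (1 / 2)).
    assert (E2 : exp (1 / 2) * exp (1 / 2) = exp 1)
      by (rewrite <- exp_plus; f_equal; lra). nra. }
  assert (P : (1 / 2) ^ S q <= exp (- (N / (2 * a)))).
  { apply Rle_trans with (exp (- (1 / 2)) ^ S q); [apply pow_incr; lra|].
    rewrite <- Rpower_pow by apply exp_pos. unfold Rpower; rewrite ln_exp.
    assert (Q : INR (S q) * - (1 / 2) <= - (N / (2 * a))).
    { rewrite S_INR. apply Rmult_le_reg_r with (2 * a); [lra|].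
      replace (- (N / (2 * a)) * (2 * a)) with (- N) by (field; lra). lra. }
    destruct Q as [Q|Q]; [now apply Rlt_le, exp_increasing|rewrite Q; lra]. }
  simpl in P; lra.
Qed.

Theorem theorem2p3 (f : R -> R -> C) (h : R -> C)
  (f_analytic : analytic2_on Pi_set f)
  (h_trace : boundary_trace f h)
  (h_analytic : analytic1_on unit_segment h)
  (f_left : exists delta : R, 0 < delta /\
     forall y : R, unit_segment y -> slit_continuation f h delta y) :
  exists R0 : R, 1 < R0 /\
  forall rad : R, R0 <= rad ->
  forall sigma : R, 0 < sigma ->
  exists (K : R) (d : nat -> nat)
         (s : nat -> nat -> C -> C) (p : nat -> C -> C -> C),
    0 < K /\
    (forall n : nat, (1 <= n)%nat ->
       (forall j : nat, (j < n)%nat -> poly1_deg_le (d n) (s n j)) /\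
       poly2_deg_le (d n) (p n)) /\
    is_bigO (fun n : nat => Finite (INR (d n)))
            (fun n : nat => sqrt (INR n)) /\
    is_bigO (fun n : nat => sup_norm_Pi (fun x y : R =>
               (f x y - rational_form n (pole rad sigma n) (s n) (p n)
                          (RtoC x) (RtoC y))%C))
            (fun n : nat => exp (- K * sqrt (INR n))).
Proof.
  destruct f_left as [delta [Hdelta Hleft]].
  destruct (uniform_local_approx f h delta f_analytic Hdelta Hleft)
    as [e [He [Hloc Htrace]]].
  destruct (growth_dominates e He) as [p0 [Hp0 Hgrow]].
  assert (Hie : 2 <= / e).
  { rewrite <- (Rinv_inv 2); apply Rinv_le_contravar; lra. }
  assert (Hp' : exists p', (1 - e * e / 4) ^ p' * (3 * / e) <= 1 / 16).
  { destruct (pow_lt_1_zero (1 - e * e / 4)) with (y := e / 48) as [N HN].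
    - rewrite Rabs_pos_eq; nra.
    - lra.
    - exists N; specialize (HN N (Nat.le_refl _)).
      apply Rle_trans with (e / 48 * (3 * / e)).
      + apply Rmult_le_compat_r; [lra|].
        eapply Rle_trans; [apply Rle_abs|lra].
      + apply Req_le; field; lra. }
  destruct Hp' as [p' Hp'].
  exists 2; split; [lra|]. intros rad Hrad sigma Hsigma.
  assert (Hm : forall n, exists m : nat,
    INR m <= sqrt (INR n) / sigma < INR m + 1).
  { intros n; destruct (nfloor_ex (sqrt (INR n) / sigma)) as [m Hm]; [|now exists m].
    apply Rmult_le_pos; [apply sqrt_pos|apply Rlt_le, Rinv_0_lt_compat; auto]. }
  set (mm := fun n => proj1_sig (constructive_indefinite_description _ (Hm n))).
  assert (Hmm : forall n, INR (mm n) <= sqrt (INR n) / sigma < INR (mm n) + 1)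
    by (intros n; exact (proj2_sig (constructive_indefinite_description _ (Hm n)))).
  clearbody mm; clear Hm.
  (* [mm n] poles lie near each point; this is the largest degree to which
     [decay_beats_growth] then applies. *)
  set (q := fun n => (mm n / (2 * p0))%nat).
  assert (Hq : forall n, (2 * p0 * q n <= mm n)%nat)
    by (intros n; apply Nat.Div0.mul_div_le).
  assert (Hq' : forall n, (mm n < 2 * p0 * (q n + 1))%nat)
    by (intros n; unfold q; rewrite Nat.add_1_r; apply Nat.mul_succ_div_gt; lia).
  set (a := 2 * INR p0 * sigma).
  assert (Hp0' : 1 <= INR p0) by (apply (le_INR 1); auto).
  assert (Ha : 0 < a) by (unfold a; nra).
  assert (Hqa : forall n, sqrt (INR n) <= a * (INR (q n) + 1)).
  { intros n; destruct (Hmm n) as [_ M].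
    assert (M' : INR (mm n) + 1 <= 2 * INR p0 * (INR (q n) + 1)).
    { specialize (Hq' n). apply le_INR in Hq'.
      rewrite S_INR, !mult_INR, plus_INR in Hq'. simpl in Hq'. lra. }
    apply Rmult_le_reg_r with (/ sigma); [now apply Rinv_0_lt_compat|].
    replace (a * (INR (q n) + 1) * / sigma) with (2 * INR p0 * (INR (q n) + 1))
      by (unfold a; field; lra). unfold Rdiv in M; lra. }
  set (d := fun n => (q n + (q n + p' * q n))%nat).
  set (K := Rmin (/ (2 * a)) (delta * sigma / 2)).
  (* Beyond [N0] the poles reach below [tau], and [4 * tau < e]; for smaller [n] the
     zero function is used. *)
  set (N0 := 1 + 2 * (ln rad + sigma + 1) / sigma + 8 / (e * sigma)).
  (* [C1 * 8 ^ q n] bounds the number of pairs of weights; the factor [16 ^ (- q n)]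
     of [far_error] absorbs it. *)
  set (C1 := (a * a + 1) * (INR p' + 1)).
  set (C0 := / e * 2 + 2 * / e * Rpower 4 delta + 3 * / e * C1 * 2).
  assert (Hlr : 0 <= ln rad) by (rewrite <- ln_1; apply ln_le; lra).
  assert (HN0 : 1 <= N0 /\ 2 * (ln rad + sigma + 1) / sigma <= N0 /\ 8 / (e * sigma) < N0).
  { assert (0 <= 2 * (ln rad + sigma + 1) / sigma)
      by (apply Rmult_le_pos; [lra|apply Rlt_le, Rinv_0_lt_compat; auto]).
    assert (0 < 8 / (e * sigma)) by (apply Rdiv_lt_0_compat; nra).
    unfold N0; lra. }
  destruct HN0 as [HN1 [HN2 HN3]].
  assert (Main : forall n, exists (sp : (nat -> C -> C) * (C -> C -> C)),
    (forall j, poly1_deg_le (d n) (fst sp j)) /\ poly2_deg_le (d n) (snd sp) /\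
    (N0 <= sqrt (INR n) -> forall x y, Pi_set x y ->
      Cmod (f x y - rational_form n (pole rad sigma n) (fst sp) (snd sp)
                      (RtoC x) (RtoC y))%C <= C0 * exp (- K * sqrt (INR n)))).
  { intros n. destruct (Rle_dec N0 (sqrt (INR n))) as [Hn|Hn].
    2: { exists (fun _ _ => RtoC 0, fun _ _ => RtoC 0); simpl.
         split; [intros; apply poly1_const|split; [apply poly2_zero|easy]]. }
    set (N := sqrt (INR n)) in *.
    assert (HNN : N * N = INR n) by (apply sqrt_sqrt, pos_INR).
    set (eta := sigma / N).
    assert (Heta : 0 < eta) by (apply Rdiv_lt_0_compat; lra).
    set (b := fun j => rad * exp (- (eta * INR j))).
    (* About halfway, on the logarithmic scale, to the smallest pole. *)
    set (tau := exp (- (sigma * N / 2))).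
    assert (Hbpos : forall i, 0 < b i).
    { intros i; apply Rmult_lt_0_compat; [lra|apply exp_pos]. }
    assert (Hbinj : forall i j, b i = b j -> i = j).
    { intros i j E; unfold b in E. apply Rmult_eq_reg_l in E; [|lra].
      apply exp_inv in E. apply INR_eq. nra. }
    assert (Ht0 : 0 < tau) by apply exp_pos.
    assert (Hte : 4 * tau < e).
    { unfold tau; rewrite exp_Ropp.
      assert (X : 4 / e < sigma * N / 2).
      { apply Rmult_lt_reg_r with (2 / sigma); [apply Rdiv_lt_0_compat; lra|].
        replace (sigma * N / 2 * (2 / sigma)) with N by (field; lra).
        replace (4 / e * (2 / sigma)) with (8 / (e * sigma)) by (field; lra). lra. }
      assert (X1 := exp_ineq1_le (sigma * N / 2)).
      assert (X0 : 0 < 4 / e) by (apply Rdiv_lt_0_compat; lra).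
      apply Rmult_lt_reg_r with (exp (sigma * N / 2)); [apply exp_pos|].
      rewrite Rmult_assoc, Rinv_l by (assert (H := exp_pos (sigma * N / 2)); lra).
      assert (X2 : 4 / e < exp (sigma * N / 2)) by lra.
      apply Rmult_lt_compat_l with (r := e) in X2; [|lra].
      replace (e * (4 / e)) with 4 in X2 by (field; lra). lra. }
    assert (Hdense : forall g, tau <= g <= 1 -> exists i0, (i0 + mm n <= n)%nat /\
      forall i, (i0 <= i < i0 + mm n)%nat -> g / 4 <= b i <= g).
    { apply exp_poles_dense; try lra.
      - destruct (Hmm n) as [M _]. fold N in M. unfold eta.
        apply Rle_trans with (N / sigma * (sigma / N)).
        + apply Rmult_le_compat_r; [exact (Rlt_le _ _ Heta)|exact M].
        + apply Req_le; field; lra.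
      - rewrite ln_div by lra. unfold tau; rewrite ln_exp, <- HNN.
        replace (eta * (N * N)) with (sigma * N) by (unfold eta; field; lra).
        assert (eta <= sigma).
        { unfold eta, Rdiv. rewrite <- (Rmult_1_r sigma) at 2.
          apply Rmult_le_compat_l; [lra|]. rewrite <- Rinv_1.
          apply Rinv_le_contravar; lra. }
        assert (ln rad + sigma + 1 <= sigma * N / 2); [|lra].
        apply Rmult_le_reg_r with (2 / sigma); [apply Rdiv_lt_0_compat; lra|].
        replace (sigma * N / 2 * (2 / sigma)) with N by (field; lra).
        replace ((ln rad + sigma + 1) * (2 / sigma))
          with (2 * (ln rad + sigma + 1) / sigma) by (field; lra). lra. }
    destruct (rational_approximation f h delta e p0 p' Hdelta He Hloc Htrace Hgrow Hp'
      b n (mm n) (q n) tau Hbpos Hbinj (conj Ht0 Hte) (Hq n) Hdense)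
      as [g [[s [p [Hs [Hp Hg]]]] Herr]].
    exists (s, p); simpl. split; [exact Hs|split; [exact Hp|]].
    intros _ x y HP. specialize (Herr x y HP). rewrite Hg in Herr by apply HP.
    replace (rational_form n (pole rad sigma n) s p (RtoC x) (RtoC y))
      with (rational_form n (fun j => - b j) s p (RtoC x) (RtoC y)).
    2: { unfold rational_form. f_equal. apply csum_ext; intros k Hk.
         replace (- b k) with (pole rad sigma n k); [reflexivity|].
         unfold pole, b, eta; fold N.
         replace (- sigma * INR k / N) with (- (sigma / N * INR k)) by (field; lra). ring. }
    apply Rle_trans with (1 := Herr).
    assert (Hhalf := half_pow_le_exp (q n) N a Ha (Hqa n)).
    assert (HK1 : exp (- (N / (2 * a))) <= exp (- K * N)).
    { assert (Q : - (N / (2 * a)) <= - K * N).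
      { assert (M := Rmin_l (/ (2 * a)) (delta * sigma / 2)). fold K in M.
        unfold Rdiv; nra. }
      destruct Q as [Q|Q]; [now apply Rlt_le, exp_increasing|rewrite Q; lra]. }
    assert (HK2 : Rpower (4 * tau) delta <= Rpower 4 delta * exp (- K * N)).
    { unfold Rpower. rewrite ln_mult by lra. unfold tau at 1; rewrite ln_exp.
      rewrite Rmult_plus_distr_l, exp_plus.
      apply Rmult_le_compat_l; [apply Rlt_le, exp_pos|].
      assert (Q : delta * - (sigma * N / 2) <= - K * N).
      { assert (M := Rmin_r (/ (2 * a)) (delta * sigma / 2)). fold K in M. nra. }
      destruct Q as [Q|Q]; [now apply Rlt_le, exp_increasing|rewrite Q; lra]. }
    assert (HC1 : INR (S n) * INR (S (p' * q n)) <= C1 * 8 ^ q n).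
    { assert (Q1 := INR_S_le_pow2 (q n)). assert (Q0 := pos_INR (q n)).
      assert (Hn1 : INR (S n) <= (a * a + 1) * (2 ^ q n * 2 ^ q n)).
      { rewrite S_INR, <- HNN.
        assert (N <= a * 2 ^ q n).
        { apply Rle_trans with (1 := Hqa n). apply Rmult_le_compat_l; lra. }
        assert (N * N <= (a * 2 ^ q n) * (a * 2 ^ q n)) by (apply Rmult_le_compat; lra).
        assert (1 <= 2 ^ q n * 2 ^ q n) by nra. lra. }
      assert (Hl1 : INR (S (p' * q n)) <= (INR p' + 1) * 2 ^ q n).
      { rewrite S_INR, mult_INR. assert (P0 := pos_INR p'). nra. }
      unfold C1. replace 8 with (2 * (2 * 2)) by lra. rewrite !Rpow_mult_distr.
      replace ((a * a + 1) * (INR p' + 1) * (2 ^ q n * (2 ^ q n * 2 ^ q n)))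
        with ((a * a + 1) * (2 ^ q n * 2 ^ q n) * ((INR p' + 1) * 2 ^ q n)) by ring.
      apply Rmult_le_compat; auto using pos_INR. }
    assert (Hfar : INR (S n) * (INR (S (p' * q n)) * far_error e (q n))
      <= 3 * / e * C1 * (1 / 2) ^ q n).
    { unfold far_error.
      replace (3 * / e * C1 * (1 / 2) ^ q n)
        with (C1 * 8 ^ q n * (3 * / e * (1 / 16) ^ q n))
        by (replace (1 / 2) with (8 * (1 / 16)) by lra; rewrite Rpow_mult_distr; ring).
      rewrite <- Rmult_assoc. apply Rmult_le_compat_r; [|exact HC1].
      apply Rmult_le_pos; [lra|apply pow_le; lra]. }
    assert (HC1' : 0 <= C1).
    { unfold C1; assert (P0 := pos_INR p'). nra. }
    unfold near_error, C0.
    set (E := exp (- K * N)) in *.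
    assert (Hh2 : (1 / 2) ^ q n <= 2 * E) by lra.
    assert (T1 : / e * (1 / 2) ^ q n <= / e * (2 * E)) by (apply Rmult_le_compat_l; lra).
    assert (T2 : 2 * / e * Rpower (4 * tau) delta <= 2 * / e * (Rpower 4 delta * E))
      by (apply Rmult_le_compat_l; lra).
    assert (T3 : 3 * / e * C1 * (1 / 2) ^ q n <= 3 * / e * C1 * (2 * E)).
    { apply Rmult_le_compat_l; [apply Rmult_le_pos; lra|lra]. }
    lra. }
  set (sp := fun n => proj1_sig (constructive_indefinite_description _ (Main n))).
  assert (Hsp : forall n, (forall j, poly1_deg_le (d n) (fst (sp n) j)) /\
    poly2_deg_le (d n) (snd (sp n)) /\
    (N0 <= sqrt (INR n) -> forall x y, Pi_set x y ->
      Cmod (f x y - rational_form n (pole rad sigma n) (fst (sp n)) (snd (sp n))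
                      (RtoC x) (RtoC y))%C <= C0 * exp (- K * sqrt (INR n))))
    by (intros n; exact (proj2_sig (constructive_indefinite_description _ (Main n)))).
  clearbody sp; clear Main.
  exists K, d, (fun n => fst (sp n)), (fun n => snd (sp n)).
  split; [|split; [|split]].
  - apply Rmin_glb_lt; [apply Rinv_0_lt_compat; lra|nra].
  - intros n _; destruct (Hsp n) as [H1 [H2 _]]; auto.
  - exists ((2 + INR p') * / sigma); exists O; intros n _.
    change (INR (d n) <= (2 + INR p') * / sigma * sqrt (INR n)).
    destruct (Hmm n) as [M _].
    assert (Q : INR (q n) <= INR (mm n)).
    { apply le_INR; specialize (Hq n); nia. }
    unfold d; rewrite !plus_INR, mult_INR. assert (P0 := pos_INR p').
    unfold Rdiv in M. apply Rle_trans with ((2 + INR p') * INR (mm n)); [nra|].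
    rewrite Rmult_assoc, (Rmult_comm (/ sigma)). apply Rmult_le_compat_l; lra.
  - exists C0. destruct (nfloor_ex (N0 * N0)) as [n0 [_ Hn0]]; [nra|].
    exists (S n0); intros n Hn.
    unfold sup_norm_Pi.
    apply (proj2 (Lub_Rbar_correct _)). intros v [x [y [HP ->]]].
    destruct (Hsp n) as [_ [_ H3]]. apply H3; auto.
    rewrite <- (sqrt_square N0) by lra. apply sqrt_le_1_alt.
    apply le_INR in Hn; rewrite S_INR in Hn; lra.
Qed.
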